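(* Let $n\ge 2$, $\lambda>0$, and let $P_n(\boldsymbol\theta)=\sum_{T\subset[n]}p_T\boldsymbol\theta^T$ be an affine polynomial with $p_\varnothing=1$, $p_T\ne0$ for all $T\subset[n]$, $p_{[j]}>0$ for $j=1,\dots,n$, such that the multivariate gamma distribution $\boldsymbol\gamma_{(P_n,\lambda)}$ exists and is infinitely divisible. Let $\mathbf X=(X_1,\dots,X_n)\sim\boldsymbol\gamma_{(P_n,\lambda)}$. Write $\boldsymbol\theta'=(\theta_2,\dots,\theta_n)$ and $\mathbf w(\boldsymbol\theta')=((\theta_2-\widetilde p_2)^{-1},\dots,(\theta_n-\widetilde p_n)^{-1})$, and define $$S_{[n]\setminus[1]}(\boldsymbol\theta')=\frac{p_{[n]}}{p_1}\prod_{i=2}^n(\theta_i-\widetilde p_i)\,\big[1-R_n(0,\mathbf w(\boldsymbol\theta'))\big],\qquad B_{n-1}(\boldsymbol\theta')=\frac{p_{[n]}}{p_1}\prod_{i=2}^n(\theta_i-\widetilde p_i)\,\frac{\partial R_n}{\partial z_1}(0,\mathbf w(\boldsymbol\theta')).$$ Then $S_{[n]\setminus[1]}$ and $B_{n-1}$ are affine polynomials in $\theta_2,\dots,\theta_n$ and $$S_{[n]\setminus[1]}(\boldsymbol\theta')=\frac1{p_1}\frac{\partial}{\partial\theta_1}P_n(\boldsymbol\theta)=\sum_{T\subset\{2,\dots,n\}}\frac{p_{\{1\}\cup T}}{p_1}\boldsymbol\theta^T,\qquad B_{n-1}(\boldsymbol\theta')=-\frac1{p_1}P_n(\widetilde p_1,\boldsymbol\theta').$$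 Define further $$\mathfrak z_{n-1}(\boldsymbol\theta')=\frac{B_{n-1}(\boldsymbol\theta')}{S_{[n]\setminus[1]}(\boldsymbol\theta')}=\frac{\frac{\partial R_n}{\partial z_1}(0,\mathbf w(\boldsymbol\theta'))}{1-R_n(0,\mathbf w(\boldsymbol\theta'))},$$ $$I_1(R_n)=\{\alpha_1\in\mathbb N:\ \exists\,(\alpha_2,\dots,\alpha_n)\in\mathbb N^{n-1},\ c_{(\alpha_1,\alpha_2,\dots,\alpha_n),\lambda}(R_n)\ne0\},\qquad \mathbf G(R_n,u_1)=\sum_{\alpha_1\in I_1(R_n)}\frac{u_1^{\alpha_1}}{\alpha_1!},$$ where $[1-R_n(\mathbf z)]^{-\lambda}=\sum_{\boldsymbol\alpha\in\mathbb N^n}c_{\boldsymbol\alpha,\lambda}(R_n)\mathbf z^{\boldsymbol\alpha}$ near $\mathbf z=\mathbf 0$. Then the Laplace transform of $(X_2,\dots,X_n)$ given $X_1=x_1$ is $$L_{(X_2,\dots,X_n)}^{X_1=x_1}(\boldsymbol\theta')=\big[S_{[n]\setminus[1]}(\boldsymbol\theta')\big]^{-\lambda}\,\frac{\mathbf G\big(R_n,\mathfrak z_{n-1}(\boldsymbol\theta')x_1\big)}{\mathbf G\big(R_n,\mathfrak z_{n-1}(\mathbf 0)x_1\big)}.$$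
   Context: Notation: $\mathbb N=\{0,1,2,\dots\}$, $[n]=\{1,\dots,n\}$, $\overline T=[n]\setminus T$, $\mathbf z^T=\prod_{t\in T}z_t$, $\mathbf z^{\boldsymbol\alpha}=\prod_iz_i^{\alpha_i}$, $p_1=p_{\{1\}}$. An affine polynomial is a polynomial of degree at most one in each variable. The multivariate gamma distribution $\boldsymbol\gamma_{(P,\lambda)}$ is the probability distribution on $\mathbb R^n$ of a random vector $\mathbf X$ with $\mathbb E[\exp(-\sum_i\theta_iX_i)]=[P(\boldsymbol\theta)]^{-\lambda}$ for $\boldsymbol\theta$ in a set with non-empty interior; it is infinitely divisible if for every $t>0$, $[P(\boldsymbol\theta)]^{-\lambda t}$ is the Laplace transform of a positive measure. $\widetilde p_T=-p_{\overline T}/p_{[n]}$, $\widetilde p_i=\widetilde p_{\{i\}}$, $\boldsymbol\theta_{P_n}=(\widetilde p_1,\dots,\widetilde p_n)$. $R_n(z_1,\dots,z_n)=\sum_{T\subset[n],|T|\ge2}r_T\mathbf z^T$ with $r_T=-\frac1{p_{[n]}}\big(\prod_{i\in\overline T}\frac{\partial}{\partial\theta_i}\big)P_n(\boldsymbol\theta_{P_n})$; equivalently $P_n(\boldsymbol\theta)=p_{[n]}\prod_i(\theta_i-\widetilde p_i)\{1-R_n((\theta_1-\widetilde p_1)^{-1},\dots,(\theta_n-\widetilde p_n)^{-1})\}$. The conditional Laplace transform is $L_{(X_2,\dots,X_n)}^{X_1=x_1}(\boldsymbol\theta')=\mathbb E[\exp(-\sum_{i=2}^n\theta_iX_i)\mid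 X_1=x_1]$; the formula gives a version of it for $x_1>0$ and $\theta_i\ge0$. *)

(* Defs.v *)
(* MathComp / MathComp-Analysis. *)
From HB Require Import structures.
From mathcomp Require Import all_boot all_order all_algebra.
From mathcomp Require Import all_classical all_reals all_analysis.

Set Implicit Arguments.
Unset Strict Implicit.
Unset Printing Implicit Defensive.

Import Order.TTheory GRing.Theory Num.Theory.
Import numFieldNormedType.Exports.

Local Open Scope classical_set_scope.
Local Open Scope ring_scope.

Section PowerSeries.
Context {R : realType} {n : nat}.

Definition monomial (z : 'rV[R]_n) (alpha : {ffun 'I_n -> nat}) : R :=
  \prod_i z 0 i ^+ alpha i.

(* For all z near 0, the family (c_alpha z^alpha) is absolutely summable with
   sum f z; a signed sum is the difference of the sums of its positive and
   negative parts. *)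
Definition has_power_series (c : {ffun 'I_n -> nat} -> R)
    (f : 'rV[R]_n -> R) : Prop :=
  \forall z \near (0 : 'rV[R]_n),
    let t := fun alpha => (c alpha * monomial z alpha)%:E in
    summable [set: {ffun 'I_n -> nat}] t /\
    (\esum_(alpha in [set: {ffun 'I_n -> nat}]) t^\+ alpha -
     \esum_(alpha in [set: {ffun 'I_n -> nat}]) t^\- alpha)%E = (f z)%:E.

(* The family of coefficients of the expansion of f at 0; the default value 0
   is irrelevant as soon as f has such an expansion. *)
Definition power_series_coef (f : 'rV[R]_n -> R) : {ffun 'I_n -> nat} -> R :=
  xget (fun=> 0) [set c | has_power_series c f].

End PowerSeries.

Section AffinePolynomials.
Context {R : realType}.

Definition affine n (p : {set 'I_n} -> R) (theta : 'rV[R]_n) : R :=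
  \sum_(T : {set 'I_n}) p T * \prod_(i in T) theta 0 i.

Definition partial n (i : 'I_n) (f : 'rV[R]_n -> R) : 'rV[R]_n -> R :=
  'D_(delta_mx 0 i) f.

(* The order of differentiation is immaterial for the polynomials this is
   applied to. *)
Definition partials n (T : {set 'I_n}) (f : 'rV[R]_n -> R) : 'rV[R]_n -> R :=
  foldr (@partial n) f (enum T).

Definition ptilde n (p : {set 'I_n} -> R) (T : {set 'I_n}) : R :=
  - p (~: T)%SET / p [set: 'I_n]%SET.

Definition theta_P n (p : {set 'I_n} -> R) : 'rV[R]_n :=
  \row_i ptilde p [set i]%SET.

Definition r_ n (p : {set 'I_n} -> R) (T : {set 'I_n}) : R :=
  - (p [set: 'I_n]%SET)^-1 * partials (~: T)%SET (affine p) (theta_P p).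

Definition R_ n (p : {set 'I_n} -> R) (z : 'rV[R]_n) : R :=
  \sum_(T : {set 'I_n} | (2 <= #|T|)%N) r_ p T * \prod_(i in T) z 0 i.

(* From here on there are n.+1 variables. The first one has index ord0, and the
   i-th entry of theta' : 'rV_n is the variable of index lift ord0 i. *)
Definition cons_row n (a : R) (theta' : 'rV[R]_n) : 'rV[R]_n.+1 :=
  \row_i oapp (fun j => theta' 0 j) a (unlift ord0 i).

Definition pole_free n (p : {set 'I_n.+1} -> R) (theta' : 'rV[R]_n) : Prop :=
  forall i : 'I_n, theta' 0 i != ptilde p [set lift ord0 i]%SET.

Definition w_ n (p : {set 'I_n.+1} -> R) (theta' : 'rV[R]_n) : 'rV[R]_n :=
  \row_i (theta' 0 i - ptilde p [set lift ord0 i]%SET)^-1.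

(* S_ and B_ carry their intended values at pole_free points only, since
   0^-1 = 0. *)
Definition S_ n (p : {set 'I_n.+1} -> R) (theta' : 'rV[R]_n) : R :=
  p [set: 'I_n.+1]%SET / p [set ord0]%SET *
  (\prod_(i < n) (theta' 0 i - ptilde p [set lift ord0 i]%SET)) *
  (1 - R_ p (cons_row 0 (w_ p theta'))).

Definition B_ n (p : {set 'I_n.+1} -> R) (theta' : 'rV[R]_n) : R :=
  p [set: 'I_n.+1]%SET / p [set ord0]%SET *
  (\prod_(i < n) (theta' 0 i - ptilde p [set lift ord0 i]%SET)) *
  partial ord0 (R_ p) (cons_row 0 (w_ p theta')).

Definition zfrak n (p : {set 'I_n.+1} -> R) (theta' : 'rV[R]_n) : R :=
  B_ p theta' / S_ p theta'.

Definition c_ n (p : {set 'I_n} -> R) (lambda : R) :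
    {ffun 'I_n -> nat} -> R :=
  power_series_coef (fun z => (1 - R_ p z) `^ (- lambda)).

Definition I1 n (p : {set 'I_n.+1} -> R) (lambda : R) : set nat :=
  [set a1 | exists alpha : {ffun 'I_n.+1 -> nat},
      alpha ord0 = a1 /\ c_ p lambda alpha != 0].

Definition G_ n (p : {set 'I_n.+1} -> R) (lambda u1 : R) : R :=
  limn (fun N => \sum_(0 <= a1 < N | a1 \in I1 p lambda) u1 ^+ a1 / a1`!%:R).

End AffinePolynomials.

Section Gamma.
Context {R : realType}.

(* The Laplace transform of nu is P^(-s) on a set with non-empty interior. The
   positivity of P on that set gives the real power its usual meaning, as `^ is
   degenerate for non-positive bases. *)
Definition laplace_is_powr n (nu : {measure set (n.-tuple R) -> \bar R})
    (p : {set 'I_n} -> R) (s : R) : Prop :=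
  exists Theta : set 'rV[R]_n, Theta° !=set0 /\
    forall theta, Theta theta ->
      0 < affine p theta /\
      (\int[nu]_x (expR (- \sum_(i < n) theta 0 i * tnth x i))%:E =
       (affine p theta `^ (- s))%:E)%E.

Definition is_mgamma n (mu : probability (n.-tuple R) R)
    (p : {set 'I_n} -> R) (lambda : R) : Prop :=
  laplace_is_powr mu p lambda.

Definition mgamma_infdiv n (p : {set 'I_n} -> R) (lambda : R) : Prop :=
  forall t : R, 0 < t ->
    exists nu : {measure set (n.-tuple R) -> \bar R},
      laplace_is_powr nu p (lambda * t).

(* g is, on D, a version of x |-> E[Y | X = x], where X takes its values in D
   almost surely. *)
Definition cond_exp_version d (Omega : measurableType d)
    (Pr : probability Omega R) (D : set R) (Y X : Omega -> R)
    (g : R -> R) : Prop :=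
  [/\ Pr (X @^-1` D) = 1%E,
      Pr.-integrable [set: Omega] (EFin \o Y),
      measurable_fun D g,
      Pr.-integrable (X @^-1` D) (EFin \o (g \o X)) &
      forall A : set R, measurable A -> A `<=` D ->
        (\int[Pr]_(w in X @^-1` A) (Y w)%:E =
         \int[Pr]_(w in X @^-1` A) (g (X w))%:E)%E].

(* g is a version, for x1 > 0, of the Laplace transform at theta' of all the
   components of X but the first, given the first one. *)
Definition cond_laplace_version d (Omega : measurableType d)
    (Pr : probability Omega R) n (X : Omega -> n.+1.-tuple R)
    (theta' : 'rV[R]_n) (g : R -> R) : Prop :=
  cond_exp_version Pr [set x1 | 0 < x1]
    (fun w => expR (- \sum_(i < n) theta' 0 i * tnth (X w) (lift ord0 i)))
    (fun w => tnth (X w) ord0) g.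

End Gamma.

(* Main.v *)
(* Writing P(theta) = p_1 S(theta') (theta_1 - ptilde_1 - z(theta')), where z is
   zfrak, the claim amounts to E[exp(-theta'.X') | X_1 = x]
   = S(theta')^(-lambda) exp((z(theta') - z(0)) x).

   That G = exp on the relevant values: (1 - R)^(-lambda) has u^(-lambda-k) v^k
   times a positive constant as its coefficient of z_1^k, where u = 1 - R(0, .)
   and v = dR/dz_1(0, .), so I_1 is everything unless v vanishes identically, in
   which case zfrak = 0 and only 0 \in I_1 matters.

   The transform of X is known on some open set only. Along a coordinate axis P
   is affine, a + b t, and a positive measure whose Laplace transform is
   (a + b t)^(-lambda) near one point has this transform wherever a + b t > 0:
   its moments are those of a gamma law, and the disc of convergence of the
   moment series doubles the distance to the singularity at each recentring.
   Hence each X_i has a constant sign, the identity extends to an orthant, P is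
   positive on that orthant, and p_[j] > 0 for all j forces the orthant to be
   the positive one and all the p_T to be positive.

   Finally, both sides of the defining property of the conditional expectation
   have the same Laplace transform in theta_1. *)
Require Import Defs.
From HB Require Import structures.
From mathcomp Require Import all_boot all_order all_algebra.
From mathcomp Require Import all_classical all_reals all_analysis.
From mathcomp Require Import measurable_realfun ring lra.

Set Implicit Arguments.
Unset Strict Implicit.
Unset Printing Implicit Defensive.

Import Order.TTheory GRing.Theory Num.Theory.
Import numFieldNormedType.Exports.

Local Open Scope classical_set_scope.
Local Open Scope ring_scope.

(** * Taylor expansion of affine polynomials *)

Section AffineAlgebra.
Context {R : realType}.

(** The family [c_] is selected by choice among all expansions, so no formula for it is available.
    Statements about exponents are therefore proved for an arbitrary expansion, by restricting it to
    lines parallel to the first axis, where one-variable uniqueness applies. Existence of an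
    expansion comes from summing over words of subsets and regrouping by exponent, which replaces
    multinomial coefficients by a rearrangement of an absolutely summable family.

    The exponential arises as follows. Since P(0) = 1 and S(0) = 1, P(s, theta') = S(theta') (1 +
    p_1 (s - z(theta') + z(0))), while X_1 has transform (1 + p_1 u)^(-lambda); weighting the law of
    X_1 by exp((z(theta') - z(0)) x) is exactly the shift from s to s - z(theta') + z(0).

    The obstacle in the continuation is finiteness: outside the given open set the transform could
    be infinite. In one variable finiteness is deduced from the convergent moment series by Fatou's
    lemma; from one coordinate to the next it is deduced from monotonicity and a finite value at a
    lower corner, in the end at the origin, where the transform is the total mass. *)

Definition dcoef n (i : 'I_n) (p : {set 'I_n} -> R) (S : {set 'I_n}) : R :=
  if i \in S then 0 else p (i |: S)%SET.

Lemma affineE1 n (i : 'I_n) (p : {set 'I_n} -> R) (x : 'rV[R]_n) :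
  affine p x = \sum_(S : {set 'I_n} | i \notin S) p S * \prod_(j in S) x 0 j +
               x 0 i * affine (dcoef i p) x.
Proof.
rewrite /affine (bigID (fun S : {set 'I_n} => i \notin S)) /=; congr (_ + _).
rewrite (bigID (fun S : {set 'I_n} => i \notin S) predT) /=.
rewrite [X in _ * (_ + X)]big1 ?addr0; last first.
  by move=> S; rewrite negbK /dcoef => ->; rewrite mul0r.
rewrite mulr_sumr.
rewrite (reindex_onto (fun S => i |: S)%SET (fun S => S :\ i)%SET) /=; last first.
  by move=> S; rewrite negbK => iS; rewrite finset.setD1K.
apply: eq_big => [S|S].
  rewrite finset.setU11 /=; apply/eqP/idP => [<-|iS]; first by rewrite !inE eqxx.
  by rewrite finset.setU1K.
rewrite finset.setU11 /= => /eqP eS; rewrite /dcoef.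
have iS : i \notin S by rewrite -eS !inE eqxx.
by rewrite (negbTE iS) big_setU1 //= mulrCA.
Qed.

Lemma affine_update n (i : 'I_n) (p : {set 'I_n} -> R) (x y : 'rV[R]_n) :
  (forall j, j != i -> y 0 j = x 0 j) ->
  affine p y = affine p x + (y 0 i - x 0 i) * affine (dcoef i p) x.
Proof.
move=> yx.
have e (S : {set 'I_n}) : i \notin S ->
    \prod_(j in S) y 0 j = \prod_(j in S) x 0 j.
  by move=> iS; apply: eq_bigr => j jS; apply: yx; apply: contraNneq iS => <-.
have ed : affine (dcoef i p) y = affine (dcoef i p) x.
  apply: eq_bigr => S _; rewrite /dcoef; case: ifPn => iS; first by rewrite !mul0r.
  by rewrite e.
rewrite (affineE1 i p y) ed (affineE1 i p x).
under eq_bigr => S iS do rewrite e//.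
by ring.
Qed.

(** The difference quotient does not depend on h != 0, and the result is again [affine]: iterated
    partial derivatives become computations on coefficient families. *)
Lemma partial_affine n (i : 'I_n) (p : {set 'I_n} -> R) :
  partial i (affine p) = affine (dcoef i p).
Proof.
apply/funext => x; rewrite /partial /derive.
apply: cvg_lim => //; apply: cvg_near_cst; near=> h.
have h0 : h != 0 by near: h; exact: nbhs_dnbhs_neq.
rewrite /= (@affine_update n i p x (h *: delta_mx 0 i + x)); last first.
  by move=> j ji; rewrite !mxE (negbTE ji) andbF mulr0 add0r.
rewrite !mxE !eqxx mulr1 addrK [affine p x + _]addrC addrK.
by rewrite /GRing.scale /= mulrA mulVf// mul1r.
Unshelve. all: by end_near. Qed.

Lemma partials_affine n (T : {set 'I_n}) (p : {set 'I_n} -> R) :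
  partials T (affine p) =
  affine (fun S => if [disjoint S & T] then p (S :|: T)%SET else 0).
Proof.
rewrite /partials.
have -> : foldr (@partial R n) (affine p) (enum T) =
          affine (foldr (@dcoef n) p (enum T)).
  by elim: (enum T) => //= i s ->; rewrite partial_affine.
congr affine; apply/funext => S.
(* Repetitions are excluded because a second derivative in the same variable gives the zero
   family. *)
suff H (s : seq 'I_n) : uniq s -> forall S : {set 'I_n},
    foldr (@dcoef n) p s S =
    if [disjoint S & s] then p (S :|: [set:: s])%SET else 0.
  rewrite H ?enum_uniq//.
  have -> : [disjoint S & enum T]%B = [disjoint S & T]%B.
    by apply: eq_disjoint_r => j; rewrite mem_enum.
  by congr (if _ then p (finset.setU _ _) else _); apply/setP=> j; rewrite !inE mem_enum.
elim: s => [_ U|i s IH /= /andP[is_ us] U].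
  rewrite /= (_ : [disjoint U & _]%B) ?disjoint_has //.
    by congr p; apply/setP => j; rewrite !inE orbF.
  by rewrite disjoint_sym disjoint_has.
rewrite /dcoef [[disjoint U & _]%B]disjoint_sym disjoint_cons.
case: ifPn => iU //=; rewrite IH // disjoint_sym.
have -> : [disjoint s & (i |: U)%SET]%B = [disjoint s & U]%B.
  rewrite !disjoint_has; congr negb; apply: eq_in_has => j js.
  by rewrite !inE (_ : j == i = false)//; apply: contraNF is_ => /eqP <-.
by congr (if _ then p _ else _); apply/setP => j; rewrite !inE; case: (j == i); case: (j \in U); rewrite ?orbT.
Qed.

(** Writing each x_i as (x_i - a_i) + a_i and expanding the products gives an exact formula: the
    coefficient collected for [U] is the sum over T containing U of p_T a^(T \ U), which is the
    derivative at [a]. *)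
Lemma affine_taylor n (p : {set 'I_n} -> R) (a x : 'rV[R]_n) :
  affine p x = \sum_(U : {set 'I_n})
    partials U (affine p) a * \prod_(i in U) (x 0 i - a 0 i).
Proof.
transitivity (\sum_(T : {set 'I_n}) \sum_(U : {set 'I_n} | U \subset T)
    (p T * \prod_(i in (T :\: U)%SET) a 0 i) * \prod_(i in U) (x 0 i - a 0 i)).
  apply: eq_bigr => T _.
  under [RHS]eq_bigr => U _ do rewrite -mulrA.
  rewrite -mulr_sumr; congr (_ * _).
  (* Outside T the factor is 0 + 1, so that the product over all indices can be distributed; the
     subsets not contained in T contribute 0. *)
  transitivity (\prod_i ((if i \in T then x 0 i - a 0 i else 0) +
                          (if i \in T then a 0 i else 1))).
    rewrite big_mkcond; apply: eq_bigr => i _.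
    by case: (i \in T); rewrite ?subrK ?add0r.
  rewrite bigA_distr /= (bigID (fun U : {set 'I_n} => U \subset T)) /=.
  rewrite [X in _ + X]big1 ?addr0; last first.
    move=> U /subsetPn[i iU iT]; rewrite (bigD1 i)//= iU (negbTE iT).
    by rewrite mul0r.
  apply: eq_bigr => U UT; rewrite (bigID (fun i => i \in U)) /= mulrC; congr (_ * _).
    rewrite big_mkcond [RHS]big_mkcond; apply: eq_bigr => i _; rewrite !inE.
    by case: (i \in U); case: (i \in T).
  apply: eq_bigr => i iU; rewrite iU.
  by rewrite (fintype.subsetP UT).
under eq_bigr => T _ do rewrite big_mkcond.
rewrite exchange_big /=; apply: eq_bigr => U _; rewrite -big_mkcond /=.
rewrite partials_affine -mulr_suml; congr (_ * _); rewrite /affine.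
rewrite [RHS](bigID (fun S : {set 'I_n} => [disjoint S & U]%B)) /=.
rewrite [X in _ = _ + X]big1 ?addr0; last first.
  by move=> S /negbTE ->; rewrite mul0r.
rewrite (reindex_onto (fun S => S :|: U)%SET (fun S => S :\: U)%SET) /=; last first.
  by move=> S US; rewrite finset.setUC; apply/setP => j; rewrite !inE;
     case: (boolP (j \in U)) => //= /(fintype.subsetP US) ->.
have key (S : {set 'I_n}) : (S :|: U) :\: U == S = [disjoint S & U]%B.
  rewrite finset.setDUl finset.setDv finset.setU0.
  by apply/eqP/idP => [/finset.setDidPl//|/finset.setDidPl].
apply: eq_big => [S|S /andP[_ dS]]; first by rewrite finset.subsetUr key.
by rewrite (eqP dS) -key dS.
Qed.

(** Taylor expansion at [theta_P], with subsets replaced by their complements as in [r_]. The empty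
    set gives the constant 1. The singletons disappear because [theta_P] is the point where all
    derivatives of order n - 1 vanish, which is why [R_] starts at cardinality 2. *)
Lemma affine_R_ n (p : {set 'I_n} -> R) (x : 'rV[R]_n) :
  p [set: 'I_n]%SET != 0 ->
  (forall i, x 0 i != ptilde p [set i]%SET) ->
  affine p x = p [set: 'I_n]%SET * (\prod_i (x 0 i - ptilde p [set i]%SET)) *
     (1 - R_ p (\row_i (x 0 i - ptilde p [set i]%SET)^-1)).
Proof.
move=> pn0 xp; rewrite (affine_taylor p (theta_P p) x).
rewrite (reindex_inj (inv_inj (@finset.setCK _))) /=.
pose t i := x 0 i - ptilde p [set i]%SET.
have t0 i : t i != 0 by rewrite subr_eq0.
have E (T : {set 'I_n}) : \prod_(i in (~: T)%SET) (x 0 i - theta_P p 0 i) =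
    (\prod_i t i) * \prod_(i in T) (t i)^-1.
  rewrite [\prod_i t i](bigID (fun i => i \in T)) /= mulrAC -big_split /= [X in _ = X * _]big1 ?mul1r.
    by apply: eq_big => [i|i]; rewrite !inE ?mxE.
  by move=> i iT; rewrite divff.
under eq_bigr => T _ do rewrite E mulrCA.
rewrite -mulr_sumr [p _ * _]mulrC -mulrA; congr (_ * _).
rewrite mulrBr mulr1 /R_ mulr_sumr.
rewrite (bigD1 (finset.set0)) //= big_set0 mulr1 -sumrN; congr (_ + _).
  rewrite finset.setC0 partials_affine /affine (bigD1 finset.set0) //=.
  rewrite big_set0 mulr1 -finset.setI_eq0 finset.set0I eqxx finset.set0U big1 ?addr0 //.
  move=> S S0; rewrite -finset.setI_eq0 finset.setIT (negbTE S0).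
  by rewrite mul0r.
rewrite (bigID (fun T : {set 'I_n} => 2 <= #|T|)%N) /= [X in _ + X]big1 ?addr0.
  apply: eq_big => [T|T /andP[_ T2]].
    by case: (T =P finset.set0) => [->|]; rewrite ?cards0.
  rewrite /r_ mulNr mulNr mulrN opprK !mulrA divff // mul1r; congr (_ * _).
  by apply: eq_bigr => i _; rewrite mxE.
move=> T /andP[T0]; rewrite -leqNgt => T1.
have /cards1P[i ->] : #|T| == 1%N by rewrite eqn_leq T1 card_gt0.
rewrite partials_affine /affine.
rewrite (bigD1 finset.set0) //= (bigD1 [set i]%SET) /=; last first.
  by apply/eqP => /setP/(_ i); rewrite !inE eqxx.
rewrite big_set0 big_set1 big1 ?addr0; last first.
  move=> S /andP[S0 Si]; case: ifPn; rewrite ?mul0r // => dS.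
  have SS : S \subset [set i]%SET.
    by rewrite -(finset.setCK [set i]%SET) -finset.disjoints_subset.
  by move: SS; rewrite subset1 (negbTE S0) (negbTE Si).
rewrite !finset.disjoints_subset finset.setCK subxx finset.sub0set !finset.set0U.
rewrite finset.setUCr mxE /ptilde mulrCA divff // !mulr1 subrr mul0r //.
Qed.

(** * Splitting off the first variable *)

Section FirstVariable.
Context (n : nat) (p : {set 'I_n.+1} -> R).

Definition tail_coef (q : {set 'I_n.+1} -> R) (T : {set 'I_n}) : R :=
  q [set lift ord0 i | i in T]%SET.

Lemma cons_row0 a (t : 'rV[R]_n) : cons_row a t 0 ord0 = a.
Proof. by rewrite mxE unlift_none. Qed.

Lemma cons_rowS a (t : 'rV[R]_n) i : cons_row a t 0 (lift ord0 i) = t 0 i.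
Proof. by rewrite mxE liftK. Qed.

Lemma affine_tail (q : {set 'I_n.+1} -> R) a (t : 'rV[R]_n) :
  (forall S : {set 'I_n.+1}, ord0 \in S -> q S = 0) ->
  affine q (cons_row a t) = affine (tail_coef q) t.
Proof.
move=> q0; rewrite /affine (bigID (fun S : {set 'I_n.+1} => ord0 \in S)) /=.
rewrite big1 ?add0r; last by move=> S /q0 ->; rewrite mul0r.
rewrite (reindex_onto (fun T : {set 'I_n} => [set lift ord0 i | i in T]%SET)
   (fun S : {set 'I_n.+1} => [set i | lift ord0 i \in S]%SET)) /=; last first.
  move=> S S0; apply/setP => j; apply/imsetP/idP => [[i]|jS].
    by rewrite inE => iS ->.
  case: (unliftP ord0 j) => [i ji|j0]; last by rewrite -j0 jS in S0.
  by exists i; rewrite // inE -ji.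
have inj : injective (lift (@ord0 n)) by exact: lift_inj.
apply: eq_big => [T|T _].
  apply/andP; split.
    by apply/negP => /imsetP[i _] /eqP; rewrite (negbTE (neq_lift _ _)).
  by apply/eqP/setP => i; rewrite inE mem_imset.
by rewrite big_imset /=; [under eq_bigr do rewrite cons_rowS | move=> ? ? _ _ /inj].
Qed.

Definition R_coef m (q : {set 'I_m} -> R) (T : {set 'I_m}) : R :=
  if (2 <= #|T|)%N then r_ q T else 0.

Lemma R_affine m (q : {set 'I_m} -> R) : R_ q = affine (R_coef q).
Proof.
apply/funext => z; rewrite /R_ /affine big_mkcond; apply: eq_bigr => T _.
by rewrite /R_coef; case: ifP; rewrite ?mul0r.
Qed.

Lemma affine_cons (q : {set 'I_n.+1} -> R) a b (t : 'rV[R]_n) :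
  affine q (cons_row b t) =
  affine q (cons_row a t) + (b - a) * affine (dcoef ord0 q) (cons_row 0 t).
Proof.
have -> : affine (dcoef ord0 q) (cons_row 0 t) =
          affine (dcoef ord0 q) (cons_row a t).
  by rewrite !affine_tail // => S S0; rewrite /dcoef S0.
rewrite (@affine_update _ ord0 q (cons_row a t)) ?cons_row0 // => j.
by case: (unliftP ord0 j) => [i ->|-> /eqP//]; rewrite !cons_rowS.
Qed.

Lemma partial_cons (q : {set 'I_n.+1} -> R) a (t : 'rV[R]_n) :
  partial ord0 (affine q) (cons_row a t) =
  affine (tail_coef (dcoef ord0 q)) t.
Proof.
by rewrite partial_affine affine_tail // => S S0; rewrite /dcoef S0.
Qed.

Lemma tail_dcoefE (q : {set 'I_n.+1} -> R) T :
  tail_coef (dcoef ord0 q) T = q (ord0 |: [set lift ord0 i | i in T])%SET.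
Proof.
rewrite /tail_coef /dcoef ifF //.
by apply/negP => /imsetP[i _] /eqP; rewrite (negbTE (neq_lift _ _)).
Qed.

Hypothesis pn0 : p [set: 'I_n.+1]%SET != 0.
Hypothesis p10 : p [set ord0]%SET != 0.

(** For a = ptilde_1 + s with s != 0 the factorisation through [R_] applies, and [R_] is affine in
    z_1 = 1 / s, which produces s S - B. The pole s = 0 is then recovered because both sides are
    affine in [a], hence determined by s = 1 and s = 2. *)
Lemma affine_SB (t : 'rV[R]_n) a : pole_free p t ->
  affine p (cons_row a t) = p [set ord0]%SET *
    ((a - ptilde p [set ord0]%SET) * S_ p t - B_ p t).
Proof.
move=> pf; set a0 := ptilde p [set ord0]%SET.
have H s : s != 0 -> affine p (cons_row (a0 + s) t) =
    p [set ord0]%SET * (s * S_ p t - B_ p t).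
  move=> s0; rewrite affine_R_ //; last first.
    move=> i; case: (unliftP ord0 i) => [j ->|->]; first by rewrite cons_rowS.
    by rewrite cons_row0 -subr_eq0 addrAC subrr add0r.
  have -> : (\row_i (cons_row (a0 + s) t 0 i - ptilde p [set i]%SET)^-1) =
            cons_row s^-1 (w_ p t).
    apply/rowP => i; rewrite mxE.
    case: (unliftP ord0 i) => [j ->|->]; first by rewrite !cons_rowS mxE.
    by rewrite !cons_row0 addrAC subrr add0r.
  rewrite big_ord_recl cons_row0 addrAC subrr add0r.
  under eq_bigr do rewrite cons_rowS.
  rewrite R_affine (affine_cons _ 0) subr0 /S_ /B_ R_affine partial_affine.
  by field; rewrite s0 p10.
have ne1 : (1 : R) != 0 by exact: oner_neq0.
have ne2 : (2 : R) != 0 by rewrite pnatr_eq0.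
have := H 1 ne1; have := H 2 ne2.
rewrite (affine_cons p a0 (a0 + 2)) (affine_cons p a0 (a0 + 1)) (affine_cons p a0 a).
set A := affine p (cons_row a0 t).
set D := affine (dcoef ord0 p) _ => e2 e1.
have -> : D = p [set ord0]%SET * S_ p t by lra.
have -> : A = - (p [set ord0]%SET * B_ p t) by lra.
by ring.
Qed.

Lemma S_E (t : 'rV[R]_n) : pole_free p t ->
  S_ p t = (p [set ord0]%SET)^-1 * affine (tail_coef (dcoef ord0 p)) t.
Proof.
move=> pf; rewrite -(affine_tail 0); last by move=> S S0; rewrite /dcoef S0.
set a0 := ptilde p [set ord0]%SET.
have := affine_SB (a0 + 1) pf; rewrite (affine_cons p a0) affine_SB // -/a0.
rewrite -/a0; set D := affine _ _ => e.
by apply: (mulfI p10); rewrite mulVKf //; lra.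
Qed.

Lemma B_E (t : 'rV[R]_n) : pole_free p t ->
  B_ p t = - (p [set ord0]%SET)^-1 *
           affine p (cons_row (ptilde p [set ord0]%SET) t).
Proof.
by move=> pf; rewrite affine_SB // subrr mul0r sub0r mulNr mulKf // opprK.
Qed.

Lemma affine_scale m (q : {set 'I_m} -> R) c x :
  affine (fun T => c * q T) x = c * affine q x.
Proof. by rewrite /affine mulr_sumr; apply: eq_bigr => T _; rewrite mulrA. Qed.

Lemma affineD m (q r : {set 'I_m} -> R) x :
  affine (fun T => q T + r T) x = affine q x + affine r x.
Proof. by rewrite /affine -big_split; apply: eq_bigr => T _; rewrite mulrDl. Qed.

(** Freezing the first variable at [a] adds to each coefficient [a] times the one with the first
    index adjoined; this makes B an affine polynomial. *)
Lemma affine_cons_affine (q : {set 'I_n.+1} -> R) a :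
  exists b, forall t, affine q (cons_row a t) = affine b t.
Proof.
pose q0 (S : {set 'I_n.+1}) := if ord0 \in S then 0 else q S.
exists (fun T => tail_coef q0 T + a * tail_coef (dcoef ord0 q) T) => t.
rewrite affineD affine_scale -(affine_tail a); last by move=> S; rewrite /q0 => ->.
rewrite -(affine_tail a); last by move=> S S0; rewrite /dcoef S0.
rewrite (affineE1 ord0) cons_row0; congr (_ + _).
rewrite /affine big_mkcond; apply: eq_bigr => S _; rewrite /q0.
by case: (ord0 \in S) => /=; rewrite ?mul0r.
Qed.

End FirstVariable.
End AffineAlgebra.

(** * Power series in one variable *)

Section PowerSeriesOneVariable.
Context {R : realType}.

(** If the coefficients below [m] vanish, division by t^m leaves a series [b] with sum 0 for t != 0.
    Its coefficients grow at most geometrically, so its terms of positive degree contribute O(t),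
    and t -> 0 kills b_0 = a_m. *)
Lemma pseries_eq0 (a : R^nat) (r : R) : 0 < r ->
  (forall t, `|t| < r -> pseries a t @ \oo --> 0) -> forall k, a k = 0.
Proof.
move=> r0 a0 m; elim/ltn_ind: m => m IH.
pose b k := a (k + m)%N.
have b0 t : t != 0 -> `|t| < r -> pseries b t @ \oo --> 0.
  move=> t0 tr; have := a0 _ tr; rewrite -(cvg_shiftn m) => h.
  have -> : pseries b t = (fun N => (t ^+ m)^-1 * pseries a t (N + m)%N).
    apply/funext => N; rewrite /pseries /series /=.
    rewrite [X in _ = _ * X](@big_cat_nat _ _ _ m) ?leq_addl //=.
    rewrite [X in _ * (X + _)]big1_seq ?add0r; last first.
      by move=> i; rewrite mem_index_iota => /andP[_ /IH ->]; rewrite mul0r.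
    rewrite [X in _ * X](big_addn 0 _ m) addnK mulr_sumr; apply: eq_bigr => i _.
    by rewrite exprD [t ^+ i * _]mulrC mulrCA mulKf ?expf_neq0.
  by rewrite -[0](mulr0 (t ^+ m)^-1); apply: cvgMl_tmp.
(* Convergence at this one point bounds b_k by M / T^k; taking t <= T / 2 below makes the geometric
   ratio at most 1/2, whence the factor 2. *)
pose T := r / 2.
have T0 : 0 < T by rewrite divr_gt0.
have [C [_ HC]] : bounded_fun (fun k => b k * T ^+ k).
  apply: cvg_series_bounded; apply/cvg_ex; exists 0; apply: b0; first by rewrite gt_eqF.
  by rewrite gtr0_norm // /T; lra.
pose M := `|C| + 1.
have M0 : 0 < M by rewrite ltr_wpDl.
have bM k : `|b k| * T ^+ k <= M.
  have /HC/(_ k) : C < M by rewrite ltr_pwDr // ler_norm.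
  by rewrite /= normrM normrX (gtr0_norm T0); apply.
have key t : 0 < t <= T / 2 -> `|b 0%N| <= t * (2 * M / T).
  move=> /andP[t0 tT].
  have tr : `|t| < r.
    by rewrite gtr0_norm // (le_lt_trans tT) // /T; lra.
  have tn0 : t != 0 by rewrite gt_eqF.
  have := b0 _ tn0 tr; rewrite -(cvg_shiftS) => h.
  have {}h : `|pseries b t N.+1| + t * (2 * M / T) @[N --> \oo] -->
             `|0 : R| + t * (2 * M / T) by apply: cvgD; [apply: cvg_norm | apply: cvg_cst].
  rewrite -[leRHS]add0r -[X in X + _](normr0 R); apply: (cvgr_to_ge h).
  near=> N; rewrite /pseries /series /= big_nat_recl //= expr0 mulr1.
  set X := \sum_(0 <= i < N) _.
  suff HX : `|X| <= t * (2 * M / T).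
    by rewrite -{1}[b 0%N](addrK X) (le_trans (ler_normB _ _)) // lerD2l.
  rewrite (le_trans (ler_norm_sum _ _ _)) //.
  apply: (@le_trans _ _ (\sum_(0 <= i < N) t * (M / T) * (t / T) ^+ i)).
    apply: ler_sum => i _; rewrite normrM normrX (gtr0_norm t0).
    have := bM i.+1; rewrite -ler_pdivlMr ?exprn_gt0 // => H.
    suff -> : t * (M / T) * (t / T) ^+ i = M / T ^+ i.+1 * t ^+ i.+1.
      by rewrite ler_wpM2r // exprn_ge0 // ltW.
    rewrite expr_div_n !exprS; field.
    by rewrite expf_neq0 ?gt_eqF.
  rewrite -mulr_sumr -mulrA ler_pM2l // -[leRHS]mulrA [leRHS]mulrC.
  apply: ler_wpM2l; first by rewrite divr_ge0 // ltW.
  have q1 : t / T <= 1 / 2 by rewrite ler_pdivrMr // mulrC mul1r.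
  have q0 : 0 <= t / T by rewrite divr_ge0 // ltW.
  have := geometric_seriesE 1 (_ : t / T != 1); rewrite lt_eqF; last by lra.
  move=> /(_ erefl)/(congr1 (fun f => f N)); rewrite /series /= => E.
  under eq_bigr do rewrite -[_ ^+ _]mul1r.
  rewrite [leLHS]E mul1r ler_pdivrMr; last by lra.
  have : 0 <= (t / T) ^+ N by rewrite exprn_ge0.
  by lra.
apply/eqP; rewrite -normr_eq0 eq_le normr_ge0 andbT; apply/ler_addgt0Pl => e e0.
rewrite addr0.
have C0 : 0 < 2 * M / T by rewrite divr_gt0 // mulr_gt0.
pose t := Num.min (T / 2) (e / (2 * M / T)).
apply: (le_trans (key t _)).
  by rewrite /t lt_min ge_min lexx /= andbT; apply/andP; split; apply: divr_gt0.
by rewrite -ler_pdivlMr // /t ge_min lexx orbT.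
Unshelve. all: by end_near. Qed.

Lemma pseries_inj (a b : R^nat) (f : R -> R) (r : R) : 0 < r ->
  (forall t, `|t| < r -> pseries a t @ \oo --> f t) ->
  (forall t, `|t| < r -> pseries b t @ \oo --> f t) -> a = b.
Proof.
move=> r0 fa fb; apply/funext => k; apply/eqP; rewrite -subr_eq0; apply/eqP.
apply: (@pseries_eq0 (fun k => a k - b k) r) => // t tr.
rewrite -(subrr (f t)); have -> : pseries (fun k => a k - b k) t =
    pseries a t \- pseries b t.
  apply/funext => N; rewrite /pseries /series /= -sumrB.
  by apply: eq_bigr => i _; rewrite mulrBl.
by apply: cvgB; [apply: fa | apply: fb].
Qed.

End PowerSeriesOneVariable.

(** * The binomial series with negative exponent *)

Section BinomialSeries.
Context {R : realType}.

(* The coefficients of [(1 - x)^(-l)]. *)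
Definition negbin (l : R) (k : nat) : R := (\prod_(i < k) (l + i%:R)) / k`!%:R.

Lemma negbin0 l : negbin l 0 = 1.
Proof. by rewrite /negbin big_ord0 fact0 divr1. Qed.

Lemma negbin_gt0 l k : 0 < l -> 0 < negbin l k.
Proof.
move=> l0; rewrite divr_gt0 ?ltr0n ?fact_gt0 //.
by apply: prodr_gt0 => i _; rewrite ltr_pwDl.
Qed.

Lemma negbinS l k : k.+1%:R * negbin l k.+1 = (l + k%:R) * negbin l k.
Proof.
rewrite /negbin big_ord_recr /= factS natrM; field.
by rewrite pnatr_eq0 -lt0n fact_gt0 nat1r pnatr_eq0.
Qed.

Lemma negbin_shift l k : k.+1%:R * negbin l k.+1 = l * negbin (l + 1) k.
Proof.
rewrite /negbin big_ord_recl /= addr0 factS natrM.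
have -> : \prod_(i < k) (l + (bump 0 i)%:R) = \prod_(i < k) (l + 1 + i%:R).
  by apply: eq_bigr => i _; rewrite /bump leq0n add1n -natr1; ring.
field.
by rewrite pnatr_eq0 -lt0n fact_gt0 nat1r pnatr_eq0.
Qed.

(** Coefficient form of (1 - x) (1 - x)^(-l-1) = (1 - x)^(-l); it turns the formula for the
    derivative into a differential equation. *)
Lemma negbin_pascal l k :
  negbin (l + 1) k.+1 - negbin (l + 1) k = negbin l k.+1.
Proof.
have k0 : k.+1%:R != 0 :> R by rewrite pnatr_eq0.
apply: (mulfI k0); rewrite mulrBr negbinS negbin_shift -natr1; ring.
Qed.

(** The ratio of consecutive terms is r (l + k) / (k + 1), at most 1 as soon as k >= l / (1 - r);
    the sum of the terms up to that rank bounds them all. *)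
Lemma negbin_bounded l r : 0 < l -> 0 < r < 1 ->
  exists M, forall k, negbin l k * r ^+ k <= M.
Proof.
move=> l0 /andP[r0 r1].
pose K := (Num.truncn (l / (1 - r))).+1.
have HK k : (K <= k)%N -> negbin l k.+1 * r ^+ k.+1 <= negbin l k * r ^+ k.
  move=> Kk; rewrite exprS mulrA ler_pM2r ?exprn_gt0 //.
  rewrite -(ler_pM2l (ltr0Sn R k)) mulrA negbinS -mulrA mulrCA [leRHS]mulrC.
  rewrite ler_wpM2l ?ltW ?negbin_gt0 //.
  have : l / (1 - r) <= k%:R.
    by rewrite (le_trans (ltW (truncnS_gt _))) // ler_nat.
  rewrite ler_pdivrMr -?natr1 ?subr_gt0 //; nra.
exists (\sum_(0 <= j < K.+1) negbin l j * r ^+ j) => k.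
have pos j : 0 <= negbin l j * r ^+ j.
  by rewrite mulr_ge0 ?exprn_ge0 // ltW // negbin_gt0.
have small j : (j <= K)%N -> negbin l j * r ^+ j <= \sum_(0 <= j < K.+1) negbin l j * r ^+ j.
  move=> jK; rewrite (bigD1_seq j) ?mem_index_iota ?iota_uniq //= lerDl.
  by apply: sumr_ge0.
have [/small//|Kk] := leqP k K.
elim: k Kk => // k IH; rewrite ltnS leq_eqVlt => /orP[/eqP <-|Kk].
  by apply: (le_trans (HK _ _)) => //; exact: small.
by apply: (le_trans (HK _ (ltnW Kk))); exact: IH.
Qed.

Lemma is_cvg_negbin l x : 0 < l -> `|x| < 1 -> cvgn (pseries (negbin l) x).
Proof.
move=> l0 x1; pose r := (1 + `|x|) / 2.
have xr : `|x| < r by rewrite /r; lra.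
have r01 : 0 < r < 1 by rewrite /r; have := normr_ge0 x; lra.
have r0 : 0 < r by case/andP: r01.
have [M HM] := negbin_bounded l0 r01.
apply: normed_cvg; rewrite /normed_series_of /=.
apply: (@series_le_cvg _ _ (geometric M (`|x| / r))) => //.
- move=> k /=; rewrite mulr_ge0 ?exprn_ge0 ?divr_ge0 ?(ltW r0) //.
  by rewrite (le_trans _ (HM 0%N)) // expr0 mulr1 negbin0.
- move=> k /=; rewrite normrM normrX gtr0_norm ?negbin_gt0 //.
  rewrite expr_div_n [leRHS]mulrCA [leLHS]mulrC ler_wpM2l ?exprn_ge0 //.
  by rewrite ler_pdivlMr ?exprn_gt0.
- apply: is_cvg_geometric_series.
  by rewrite ger0_norm ?divr_ge0 ?(ltW r0) // ltr_pdivrMr // mul1r.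
Qed.

Lemma pseries_diffs_negbin l :
  pseries_diffs (negbin l) = (fun k => l * negbin (l + 1) k).
Proof. by apply/funext => k; rewrite /pseries_diffs negbin_shift. Qed.

Lemma pseriesZ (c : R) a x :
  pseries (fun k => c * a k) x = (fun N => c * pseries a x N).
Proof.
apply/funext => N; rewrite /pseries /series /= mulr_sumr.
by apply: eq_bigr => i _; rewrite mulrA.
Qed.

Lemma pseries_diffsZ (c : R) a :
  pseries_diffs (fun k => c * a k) = (fun k => c * pseries_diffs a k).
Proof. by apply/funext => k; rewrite /pseries_diffs mulrCA. Qed.

Lemma lim_negbin_pascal l x : 0 < l -> `|x| < 1 ->
  limn (pseries (negbin l) x) = (1 - x) * limn (pseries (negbin (l + 1)) x).
Proof.
move=> l0 x1; have l1 : 0 < l + 1 by rewrite ltr_wpDl // ltW.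
apply: cvg_lim => //; rewrite -(cvg_shiftS).
have -> : [sequence pseries (negbin l) x n.+1]_n =
    (fun n => pseries (negbin (l + 1)) x n.+1 - x * pseries (negbin (l + 1)) x n).
  apply/funext => n; rewrite /pseries /series /= !big_nat_recl //= !expr0 !mulr1.
  rewrite !negbin0 -addrA; congr (_ + _); rewrite mulr_sumr -sumrB.
  by apply: eq_bigr => i _; rewrite -negbin_pascal exprS; ring.
rewrite mulrBl mul1r; apply: cvgB; last by apply: cvgMl_tmp; apply: is_cvg_negbin.
by rewrite (cvg_shiftS (pseries (negbin (l + 1)) x)); apply: is_cvg_negbin.
Qed.

Lemma is_derive_negbin (l x : R) : 0 < l -> `|x| < 1 ->
  is_derive x (1 : R) (fun x : R => limn (pseries (negbin l) x))
    (l * limn (pseries (negbin (l + 1)) x)).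
Proof.
move=> l0 x1; have l1 : 0 < l + 1 by rewrite ltr_wpDl // ltW.
have l2 : 0 < l + 1 + 1 by rewrite ltr_wpDl // ltW.
(* Termwise differentiation requires the series and its first two derived series to converge at a
   radius beyond |x|; the midpoint between |x| and 1 is one. *)
pose r := (1 + `|x|) / 2.
have r0 : 0 < r by rewrite /r; have := normr_ge0 x; lra.
have xr : `|x| < `|r| by rewrite (gtr0_norm r0) /r; lra.
have r1 : `|r| < 1 by rewrite (gtr0_norm r0) /r; lra.
have -> : l * limn (pseries (negbin (l + 1)) x) =
          limn (pseries (pseries_diffs (negbin l)) x).
  rewrite pseries_diffs_negbin pseriesZ; apply/esym/cvg_lim => //.
  by apply: cvgMl_tmp; apply: is_cvg_negbin.
apply: (@pseries_snd_diffs R (negbin l) r) => //.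
- exact: is_cvg_negbin.
- by rewrite pseries_diffs_negbin pseriesZ; apply: is_cvgMl_tmp; exact: is_cvg_negbin.
- rewrite pseries_diffs_negbin pseries_diffsZ pseries_diffs_negbin pseriesZ.
  by apply: is_cvgMl_tmp; rewrite pseriesZ; apply: is_cvgMl_tmp; exact: is_cvg_negbin.
Qed.

(** The sum g satisfies (1 - x) g' = l g, so that g (1 - x)^l has derivative 0 on ]-1, 1[ and keeps
    its value 1 at the origin. *)
Lemma cvg_negbin (l x : R) : 0 < l -> `|x| < 1 ->
  pseries (negbin l) x @ \oo --> (1 - x) `^ (- l).
Proof.
move=> l0 x1.
pose g (y : R) : R := limn (pseries (negbin l) y).
pose h (y : R) : R := g y * expR (l * ln (1 - y)).
have dh (y : R) : `|y| < 1 -> is_derive y (1 : R) h 0.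
  move=> y1; have y1' : 0 < 1 - y by move: y1; rewrite ltr_norml; lra.
  have dg : is_derive y (1 : R) g _ := is_derive_negbin l0 y1.
  have d1 : is_derive y (1 : R) (fun y : R => 1 - y) (0 - 1).
    exact: (is_deriveB (is_derive_cst (1 : R) y (1 : R)) (is_derive_id y (1 : R))).
  have dl : is_derive y (1 : R) (@ln R \o (fun y : R => 1 - y)) _ :=
    @is_derive1_comp R (@ln R) (fun y : R => 1 - y) y _ _ (is_derive1_ln y1') d1.
  have dE : is_derive y (1 : R) (@expR R \o (l *: (@ln R \o (fun y : R => 1 - y)))) _ :=
    @is_derive1_comp R (@expR R) (l *: (@ln R \o (fun y : R => 1 - y))) y _ _
      (is_derive_expR _) (is_deriveZ l dl).
  have -> : h = g * (@expR R \o (l *: (@ln R \o (fun y : R => 1 - y)))) by [].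
  apply: is_derive_eq.
  rewrite /g lim_negbin_pascal // /GRing.scale /= /GRing.scale /=.
  by field; rewrite gt_eqF.
have hx : h x = h 0.
  have ch (a b : R) : -1 < a -> b < 1 -> {within `[a, b], continuous h}.
    move=> a1 b1; apply: derivable_within_continuous => y.
    rewrite in_itv /= => /andP[ay yb].
    by have /dh[] : `|y| < 1 by rewrite ltr_norml; lra.
  have [xn xp] : -1 < x /\ x < 1 by move: x1; rewrite ltr_norml => /andP.
  have bd (a b y : R) : -1 < a -> b < 1 -> y \in `]a, b[ -> is_derive y (1 : R) h 0.
    by move=> a1 b1; rewrite in_itv /= => /andP[ay yb]; apply: dh; rewrite ltr_norml; lra.
  have [x0|x0] := leP 0 x.
    have [||c _] := @MVT_segment R h (fun=> 0) 0 x x0.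
    - by move=> y; apply: bd => //; lra.
    - by apply: ch => //; lra.
    - by rewrite mul0r => /eqP; rewrite subr_eq0 => /eqP.
  have [||c _] := @MVT_segment R h (fun=> 0) x 0 (ltW x0).
  - by move=> y; apply: bd => //; lra.
  - by apply: ch => //; lra.
  - by rewrite mul0r => /eqP; rewrite subr_eq0 => /eqP.
have g0 : g 0 = 1.
  apply: cvg_lim => //; apply: cvg_near_cst; exists 1%N => // -[|N] //= _.
  rewrite /pseries /series /= big_nat_recl // expr0 mulr1 negbin0 big1 ?addr0 //.
  by move=> i _; rewrite expr0n mulr0.
suff -> : (1 - x) `^ (- l) = g x by exact: is_cvg_negbin.
move: hx; rewrite /h g0 subr0 ln1 mulr0 expR0 mulr1 => hx.
rewrite powRN /powR ifF; last by apply/negbTE; move: x1; rewrite ltr_norml; lra.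
have E0 : expR (l * ln (1 - x)) != 0 by rewrite gt_eqF ?expR_gt0.
by apply: (mulIf E0); rewrite hx mulVf.
Qed.

End BinomialSeries.

(** * Signed sums over countable types *)

Section SignedSums.
Context {R : realType}.
Implicit Types I J : choiceType.

(* [has_power_series c f] says that, for z near 0, the family
   [c alpha * monomial z alpha] has the signed sum [f z]. *)
Definition signed_sum I (x : I -> R) (v : R) : Prop :=
  let t := fun i => (x i)%:E in
  summable [set: I] t /\
  (\esum_(i in [set: I]) t^\+ i - \esum_(i in [set: I]) t^\- i)%E = v%:E.

Lemma signed_sum_unique I (x : I -> R) v w :
  signed_sum x v -> signed_sum x w -> v = w.
Proof. by move=> [_ +] [_ +] => -> []. Qed.

(** Any splitting into two nonnegative families with finite sums computes the signed sum, not only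
    the one into positive and negative parts. Scaling and regrouping then reduce to nonnegative
    families. *)
Lemma signed_sumP I (x : I -> R) v :
  signed_sum x v <->
  exists y z : I -> R, exists Y Z : R,
   [/\ (forall i, 0 <= y i), (forall i, 0 <= z i), (forall i, x i = y i - z i) &
   [/\ \esum_(i in [set: I]) (y i)%:E = Y%:E,
       \esum_(i in [set: I]) (z i)%:E = Z%:E & v = Y - Z]].
Proof.
split=> [[sx]|[y [z [Y [Z [y0 z0 xE [yY zZ ->]]]]]]].
- have fin (f : I -> \bar R) : (forall i, 0 <= f i)%E -> summable [set: I] f ->
      (\esum_(i in [set: I]) f i)%E \is a fin_num.
    move=> f0; rewrite summableE => h.
    rewrite (_ : esum _ f = \esum_(i in [set: I]) `|f i|%E) //.
    by apply: eq_esum => i _; rewrite gee0_abs.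
  have fp := fin _ _ (summable_funepos sx).
  have fn := fin _ _ (summable_funeneg sx).
  rewrite -(fineK (fp _)) // -(fineK (fn _)) //.
  rewrite -EFinB => -[<-].
  exists (fun i => Num.max (x i) 0), (fun i => Num.max (- x i) 0).
  eexists; eexists; split.
  + by move=> i; rewrite le_max lexx orbT.
  + by move=> i; rewrite le_max lexx orbT.
  + by move=> i; have [?|?] := leP 0 (x i); rewrite /Num.max; do 2 case: ltP; lra.
  + split; last reflexivity; rewrite fineK ?fp ?fn //.
    * by apply: eq_esum => i _; rewrite funeposE /= EFin_max.
    * by apply: eq_esum => i _; rewrite funenegE /= EFin_max.
- have ysum : summable [set: I] (fun i => (y i)%:E).
    rewrite /summable (_ : esum _ _ = Y%:E) ?ltry // -yY.
    by apply: eq_esum => i _; rewrite gee0_abs // lee_fin.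
  have zsum : summable [set: I] (fun i => (z i)%:E).
    rewrite /summable (_ : esum _ _ = Z%:E) ?ltry // -zZ.
    by apply: eq_esum => i _; rewrite gee0_abs // lee_fin.
  have -> : x = (fun i => y i - z i) by apply/funext.
  split; first exact: (summableB ysum zsum).
  rewrite EFinB -yY -zZ -(esumB ysum zsum) // => i _; rewrite lee_fin //.
Qed.

Lemma signed_sum_exists I (x : I -> R) :
  summable [set: I] (fun i => (x i)%:E) -> exists v, signed_sum x v.
Proof.
move=> sx.
have fin (f : I -> \bar R) : (forall i, 0 <= f i)%E -> summable [set: I] f ->
      (\esum_(i in [set: I]) f i)%E \is a fin_num.
    move=> f0; rewrite summableE => h.
    rewrite (_ : esum _ f = \esum_(i in [set: I]) `|f i|%E) //.
    by apply: eq_esum => i _; rewrite gee0_abs.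
have fp := fin _ (fun=> _) (summable_funepos sx).
have fn := fin _ (fun=> _) (summable_funeneg sx).
eexists; split=> //; rewrite -(fineK (fp _)) // -(fineK (fn _)) // -EFinB.
Qed.

Lemma ge0_esumZl I (c : R) (y : I -> \bar R) : 0 <= c -> (forall i, 0 <= y i)%E ->
  (\esum_(i in [set: I]) (c%:E * y i) = c%:E * \esum_(i in [set: I]) y i)%E.
Proof.
move=> c0 y0.
have le1 (d : R) (u : I -> \bar R) : 0 <= d -> (forall i, 0 <= u i)%E ->
   (\esum_(i in [set: I]) (d%:E * u i) <= d%:E * \esum_(i in [set: I]) u i)%E.
  move=> d0 u0; apply: ge_ereal_sup => _ [F [finF _] <-].
  rewrite fsbig_finite //= -ge0_sume_distrr //.
  rewrite lee_wpmul2l ?lee_fin //; apply: ereal_sup_ubound; exists F => //.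
  by rewrite fsbig_finite.
move: c0; rewrite le_eqVlt => /orP[/eqP <-|c0].
  by rewrite mul0e; apply: esum1 => i _; rewrite mul0e.
apply/eqP; rewrite eq_le (le1 _ _ (ltW c0) y0) /=.
have cV0 : 0 <= c^-1 by rewrite invr_ge0 ltW.
have := le1 c^-1 (fun i => c%:E * y i)%E cV0.
have e i : (c^-1%:E * (c%:E * y i) = y i)%E.
  by rewrite muleA -EFinM mulVf ?gt_eqF // mul1e.
under eq_esum do rewrite e.
have c0e : (0 <= c%:E)%E by rewrite lee_fin ltW.
move=> /(_ (fun i => mule_ge0 c0e (y0 i))) /(lee_wpmul2l c0e).
by rewrite muleA -EFinM mulfV ?gt_eqF // mul1e.
Qed.

Lemma signed_sumZ I (c : R) (x : I -> R) v :
  signed_sum x v -> signed_sum (fun i => c * x i) (c * v).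
Proof.
move=> /signed_sumP[y [z [Y [Z [y0 z0 xE [yY zZ ->]]]]]]; apply/signed_sumP.
have Zl (d : R) (u : I -> R) U : 0 <= d -> (forall i, 0 <= u i) ->
    \esum_(i in [set: I]) (u i)%:E = U%:E ->
    \esum_(i in [set: I]) (d * u i)%:E = (d * U)%:E.
  move=> d0 u0 uU; rewrite EFinM -uU -ge0_esumZl //.
have [c0|c0] := leP 0 c.
- exists (fun i => c * y i), (fun i => c * z i), (c * Y), (c * Z); split.
  + by move=> i; rewrite mulr_ge0.
  + by move=> i; rewrite mulr_ge0.
  + by move=> i; rewrite xE mulrBr.
  + by split; [exact: Zl|exact: Zl|rewrite mulrBr].
- have c0' : 0 <= - c by lra.
  exists (fun i => - c * z i), (fun i => - c * y i), (- c * Z), (- c * Y); split.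
  + by move=> i; rewrite mulr_ge0.
  + by move=> i; rewrite mulr_ge0.
  + by move=> i; rewrite xE; ring.
  + by split; [exact: Zl|exact: Zl|ring].
Qed.

(** A fibre of [phi] is encoded by zeros outside it, so that every sum ranges over a full type, as
    in [signed_sum]. *)
Lemma ge0_esum_regroup I J (phi : I -> J) (y : I -> \bar R) :
  (forall i, 0 <= y i)%E ->
  (\esum_(i in [set: I]) y i =
  \esum_(j in [set: J]) \esum_(i in [set: I]) (if phi i == j then y i else 0))%E.
Proof.
move=> y0; transitivity (\esum_(j in [set: J]) \esum_(i in [set i | phi i = j]) y i)%E.
  rewrite esum_esum //.
  apply: (@reindex_esum _ _ _ _ _ (fun k : J * I => k.2) y) => /=; split.
  - by [].
  - by move=> [j i] [j' i'] /= /set_mem[_ /= <-] /set_mem[_ /= <-] ->.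
  - by move=> i _; exists (phi i, i).
apply: eq_esum => j _; rewrite esum_mkcond; apply: eq_esum => i _.
rewrite (_ : (i \in [set i | phi i = j]) = (phi i == j)) //.
by apply/idP/eqP; rewrite inE.
Qed.

Lemma signed_sum_regroup I J (phi : I -> J) (x : I -> R) v :
  signed_sum x v -> exists2 y : J -> R,
    forall j, signed_sum (fun i => if phi i == j then x i else 0) (y j) &
    signed_sum y v.
Proof.
move=> /signed_sumP[y [z [Y [Z [y0 z0 xE [yY zZ ->]]]]]].
have H (u : I -> R) U : (forall i, 0 <= u i) ->
    \esum_(i in [set: I]) (u i)%:E = U%:E ->
    exists2 s : J -> R, (forall j, 0 <= s j /\
     \esum_(i in [set: I]) (if phi i == j then u i else 0)%:E = (s j)%:E) &
     \esum_(j in [set: J]) (s j)%:E = U%:E.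
  move=> u0 uU.
  pose e j := \esum_(i in [set: I]) (if phi i == j then u i else 0)%:E.
  have e0 j : (0 <= e j)%E.
    by apply: esum_ge0 => i _; case: ifP; rewrite ?lee_fin.
  have efin j : e j \is a fin_num.
    rewrite ge0_fin_numE // (@le_lt_trans _ _ U%:E) ?ltry // -uU.
    by apply: le_esum => i _; case: ifP; rewrite ?lee_fin.
  exists (fun j => fine (e j)).
    by move=> j; rewrite fineK // fine_ge0.
  rewrite -uU (ge0_esum_regroup phi) //.
  apply: eq_esum => j _; rewrite fineK //; apply: eq_esum => i _.
  by case: ifP.
have [s hs sY] := H _ _ y0 yY; have [t ht tZ] := H _ _ z0 zZ.
exists (fun j => s j - t j) => [j|]; apply/signed_sumP.
- exists (fun i => if phi i == j then y i else 0),
    (fun i => if phi i == j then z i else 0), (s j), (t j); split.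
  + by move=> i; case: ifP.
  + by move=> i; case: ifP.
  + by move=> i; case: ifP; rewrite ?subr0.
  + by split; [case: (hs j)|case: (ht j)|].
- exists s, t, Y, Z; split=> //.
  + by move=> j; case: (hs j).
  + by move=> j; case: (ht j).
Qed.

Lemma ge0_esum_nat (y : nat -> R) Y : (forall k, 0 <= y k) ->
  \esum_(k in [set: nat]) (y k)%:E = Y%:E <-> series y @ \oo --> Y.
Proof.
move=> y0; have y0' k : (0 <= (y k)%:E)%E by rewrite lee_fin.
have E : [sequence \sum_(0 <= k < n) (y k)%:E]_n = EFin \o series y.
  by apply/funext => n /=; rewrite sumEFin.
rewrite -nneseries_esumT //; split=> h.
  suff /fine_cvg : EFin \o series y @ \oo --> Y%:E by [].
  rewrite -h -E; exact: is_cvg_nneseries.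
apply: cvg_lim => //; rewrite [X in X @ _]E; by apply: cvg_EFin => //; exact: nearW.
Qed.

Lemma signed_sum_nat (x : nat -> R) v :
  signed_sum x v -> series x @ \oo --> v.
Proof.
move=> /signed_sumP[y [z [Y [Z [y0 z0 xE [yY zZ ->]]]]]].
have -> : series x = series y \- series z.
  by apply/funext => N; rewrite /series /= -sumrB; apply: eq_bigr => i _.
by apply: cvgB; apply/ge0_esum_nat.
Qed.

Lemma esum_finite_support I (s : seq I) (y : I -> R) :
  uniq s -> (forall i, 0 <= y i) -> (forall i, i \notin s -> y i = 0) ->
  \esum_(i in [set: I]) (y i)%:E = (\sum_(i <- s) y i)%:E.
Proof.
move=> us y0 ys; transitivity (\esum_(i in [set` s]) (y i)%:E).
  rewrite [RHS]esum_mkcond; apply: eq_esum => i _.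
  by case: ifPn => //; rewrite mem_setE => /ys ->.
rewrite esum_fset ?finite_seq // => [|i _]; last by rewrite lee_fin.
by rewrite -fsbig_seq // sumEFin.
Qed.

Lemma signed_sum_finite_support I (s : seq I) (x : I -> R) :
  uniq s -> (forall i, i \notin s -> x i = 0) ->
  signed_sum x (\sum_(i <- s) x i).
Proof.
move=> us xs; apply/signed_sumP.
exists (fun i => Num.max (x i) 0), (fun i => Num.max (- x i) 0).
exists (\sum_(i <- s) Num.max (x i) 0), (\sum_(i <- s) Num.max (- x i) 0).
have E (i : I) : x i = Num.max (x i) 0 - Num.max (- x i) 0.
  by have [?|?] := leP 0 (x i); rewrite /Num.max; do 2 case: ltP; lra.
split=> //.
- by move=> i; rewrite le_max lexx orbT.
- by move=> i; rewrite le_max lexx orbT.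
split.
- apply: esum_finite_support => // i; first by rewrite le_max lexx orbT.
  by move=> /xs ->; rewrite maxxx.
- apply: esum_finite_support => // i; first by rewrite le_max lexx orbT.
  by move=> /xs ->; rewrite oppr0 maxxx.
- by rewrite -sumrB; apply: eq_bigr => i _.
Qed.

End SignedSums.

(** * Powers of finite sums expanded over words *)

Section Words.
Context {R : realType} (T : finType).

(** Words index the fully expanded k-th power of a finite sum, every term having coefficient 1. *)
Fixpoint words (k : nat) : seq (seq T) :=
  if k is k'.+1 then [seq t :: w | t <- enum T, w <- words k'] else [:: [::]].

Lemma mem_words k w : (w \in words k) = (size w == k).
Proof.
elim: k w => [|k IH] w; first by rewrite inE; case: w.
apply/allpairsP/eqP => [[[t u] /= [_ uk ->]] /=|].
  by move: uk; rewrite IH => /eqP ->.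
case: w => // t u [/= ku]; exists (t, u); split=> //=; first by rewrite mem_enum.
by rewrite IH ku.
Qed.

Lemma words_uniq k : uniq (words k).
Proof.
elim: k => //= k IH; apply: allpairs_uniq => //; first exact: enum_uniq.
by move=> [t w] [t' w'] _ _ /= [-> ->].
Qed.

Lemma sum_words (s : T -> R) k :
  \sum_(w <- words k) \prod_(t <- w) s t = (\sum_t s t) ^+ k.
Proof.
elim: k => [|k IH] /=; first by rewrite big_seq1 big_nil.
rewrite big_allpairs_dep exprS -IH big_distrl /= big_enum /=; apply: eq_bigr => t _.
by rewrite mulr_sumr; apply: eq_bigr => w _; rewrite big_cons.
Qed.

(** Expand each power in the binomial series over words. The same series at the sum of the |s t|,
    which is below 1, gives absolute summability; regrouping by length then gives the value. *)
Lemma signed_sum_words (l : R) (s : T -> R) : 0 < l -> \sum_t `|s t| < 1 ->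
  signed_sum (fun w : seq T => negbin l (size w) * \prod_(t <- w) s t)
             ((1 - \sum_t s t) `^ (- l)).
Proof.
move=> l0 s1.
have sn1 : `|\sum_t s t| < 1 by rewrite (le_lt_trans _ s1) // ler_norm_sum.
pose x w := negbin l (size w) * \prod_(t <- w) s t.
have nb k : 0 <= negbin l k by rewrite ltW // negbin_gt0.
have size_sum k : signed_sum (fun w => if size w == k then x w else 0)
    (negbin l k * (\sum_t s t) ^+ k).
  rewrite -sum_words mulr_sumr.
  rewrite (eq_big_seq (fun w => if size w == k then x w else 0)); last first.
    by move=> w; rewrite mem_words /x => /eqP ->; rewrite eqxx.
  apply: signed_sum_finite_support (words_uniq k) _ => w.
  by rewrite mem_words => /negbTE ->.
have sx : summable [set: seq T] (fun w => (x w)%:E).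
  rewrite /summable (ge0_esum_regroup size) //.
  rewrite (_ : esum _ _ = ((1 - \sum_t `|s t|) `^ (- l))%:E) ?ltry //.
  rewrite (_ : esum _ _ = \esum_(k in [set: nat])
      (negbin l k * (\sum_t `|s t|) ^+ k)%:E).
    apply/ge0_esum_nat => [k|]; first by rewrite mulr_ge0 // exprn_ge0 // sumr_ge0.
    by apply: cvg_negbin; rewrite // ger0_norm // sumr_ge0.
  apply: eq_esum => k _; rewrite -sum_words mulr_sumr.
  rewrite (eq_big_seq (fun w => if size w == k then `|x w| else 0)); last first.
    move=> w; rewrite mem_words /x => /eqP ->; rewrite eqxx normrM ger0_norm //.
    by rewrite normr_prod.
  rewrite -(esum_finite_support (words_uniq k)).
  - by apply: eq_esum => w _; case: ifP.
  - by move=> w; case: ifP.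
  - by move=> w; rewrite mem_words => /negbTE ->.
have [v hv] := signed_sum_exists sx.
have [y hy yv] := signed_sum_regroup size hv.
suff <- : v = (1 - \sum_t s t) `^ (- l) by [].
have yE : y = (fun k => negbin l k * (\sum_t s t) ^+ k).
  by apply/funext => k; apply: signed_sum_unique (hy k) (size_sum k).
rewrite yE in yv.
exact: (cvg_unique _ (signed_sum_nat yv) (cvg_negbin l0 sn1)).
Qed.

End Words.

(** * The expansion of (1 - R)^(-lambda) *)

Section AffineExpansion.
Context {R : realType} (n : nat).
Implicit Types (q : {set 'I_n} -> R) (z : 'rV[R]_n).

Lemma near_row0P (P : 'rV[R]_n -> Prop) :
  (\forall z \near (0 : 'rV[R]_n), P z) <->
  exists2 e : R, 0 < e & forall z, (forall i, `|z 0 i| < e) -> P z.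
Proof.
split=> [/nbhs_ballP[e /= e0 H]|[e e0 H]].
  exists e => // z ze; apply: H; split=> // i j.
  by rewrite ord1 mxE; have := ze j; rewrite /ball /= sub0r normrN.
apply/nbhs_ballP; exists e => //= z ze; apply: H => i.
by have [_ /(_ 0 i)] := ze; rewrite /ball /= mxE sub0r normrN.
Qed.

Lemma affine_terms_small q : q finset.set0 = 0 ->
  exists2 e : R, 0 < e & forall z, (forall i, `|z 0 i| < e) ->
    \sum_(T : {set 'I_n}) `|q T * \prod_(i in T) z 0 i| < 1.
Proof.
move=> q0; pose M := 1 + \sum_(T : {set 'I_n}) `|q T|.
have M1 : 1 <= M by rewrite lerDl sumr_ge0.
have M0 : 0 < M by lra.
(* As M >= 1, a nonempty product of entries below M^-1 is itself at most M^-1, and the |q T| add up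
   to M - 1. *)
exists M^-1 => [|z ze]; first by rewrite invr_gt0.
apply: (@le_lt_trans _ _ (\sum_(T : {set 'I_n}) `|q T| * M^-1)); last first.
  by rewrite -mulr_suml ltr_pdivrMr // mul1r /M; lra.
apply: ler_sum => T _; rewrite normrM.
have [->|[i iT]] := set_0Vmem T; first by rewrite q0 normr0 !mul0r.
rewrite ler_wpM2l // normr_prod (bigD1 i) //=.
have -> : M^-1 = M^-1 * \prod_(j in T | j != i) 1 by rewrite big1 ?mulr1.
apply: ler_pM; rewrite ?prodr_ge0 ?(ltW (ze i)) //.
apply: ler_prod => j _; rewrite normr_ge0 /= (le_trans (ltW (ze j))) //.
by rewrite invf_le1.
Qed.

Definition word_exponent (w : seq {set 'I_n}) : {ffun 'I_n -> nat} :=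
  [ffun i => count (fun T : {set 'I_n} => i \in T) w].

Lemma prod_word q z (w : seq {set 'I_n}) :
  \prod_(T <- w) (q T * \prod_(i in T) z 0 i) =
  (\prod_(T <- w) q T) * monomial z (word_exponent w).
Proof.
rewrite big_split /=; congr (_ * _).
under eq_bigr => T _ do rewrite big_mkcond /=.
rewrite exchange_big /=; apply: eq_bigr => i _; rewrite ffunE.
by rewrite -big_mkcond /= big_const_seq iter_mulr_1.
Qed.

(** All words with one exponent give multiples of the same monomial, so the coefficient can be read
    off at a single point [z0] without zero coordinates and is then valid at every small z. *)
Lemma has_power_series_affine (l : R) q : 0 < l -> q finset.set0 = 0 ->
  exists c, has_power_series c (fun z => (1 - affine q z) `^ (- l)).
Proof.
move=> l0 q0; have [e e0 small] := affine_terms_small q0.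
pose a (w : seq {set 'I_n}) := negbin l (size w) * \prod_(T <- w) q T.
have sum_z z : (forall i, `|z 0 i| < e) ->
    signed_sum (fun w => a w * monomial z (word_exponent w))
               ((1 - affine q z) `^ (- l)).
  move=> ze; have := signed_sum_words l0 (small z ze).
  suff -> : (fun w : seq {set 'I_n} => negbin l (size w) *
     \prod_(t <- w) (q t * \prod_(i in t) z 0 i)) =
     (fun w => a w * monomial z (word_exponent w)) by [].
  by apply/funext => w; rewrite prod_word mulrA.
pose z0 : 'rV[R]_n := \row_i (e / 2).
have z0e i : `|z0 0 i| < e by rewrite mxE gtr0_norm ?divr_gt0 //; lra.
have m0 al : monomial z0 al != 0.
  apply/prodf_neq0 => i _; rewrite expf_neq0 // mxE gt_eqF // divr_gt0 //.
have [y hy _] := signed_sum_regroup word_exponent (sum_z z0 z0e).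
exists (fun al => (monomial z0 al)^-1 * y al); apply/near_row0P; exists e => // z ze.
have [y' hy' hv] := signed_sum_regroup word_exponent (sum_z z ze).
suff yE : (fun al => ((monomial z0 al)^-1 * y al * monomial z al)) = y'.
  by rewrite -yE in hv; exact: hv.
apply/funext => al; apply: (signed_sum_unique _ (hy' al)) => /=.
rewrite [_ * monomial z al]mulrC mulrA.
have := signed_sumZ (monomial z al / monomial z0 al) (hy al).
congr signed_sum; apply/funext => w.
case: ifPn => [/eqP ->|_]; last by rewrite mulr0.
by rewrite mulrCA divfK.
Qed.

Lemma affine_eq0 q (e : R) : 0 < e ->
  (forall z, (forall i, `|z 0 i| < e) -> affine q z = 0) ->
  forall z, affine q z = 0.
Proof.
move=> e0 H z.
pose P : {poly R} := \sum_(T : {set 'I_n}) (q T * \prod_(i in T) z 0 i) *: 'X^#|T|.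
have PE t : P.[t] = affine q (t *: z).
  rewrite horner_sum; apply: eq_bigr => T _.
  rewrite hornerZ hornerXn -mulrA; congr (_ * _).
  rewrite [in RHS](eq_bigr (fun i => t * z 0 i)); last by move=> i _; rewrite mxE.
  by rewrite big_split /= prodr_const mulrC.
suff P0 : P = 0 by rewrite -(scale1r z) -PE P0 horner0.
pose M := 1 + \sum_i `|z 0 i|.
have M0 : 0 < M by rewrite ltr_wpDr // sumr_ge0.
have zM i : `|z 0 i| < M.
  rewrite /M (bigD1 i) //= addrCA ltrDl ltr_wpDr // sumr_ge0 //.
(* As many distinct parameters as [size P], one more than the degree allows, all so small that the
   scaled point lies in the cube where [affine q] vanishes. *)
pose s := [seq e / M / k.+1%:R | k <- iota 0 (size P)].
apply/eqP/negPn/negP => Pn0.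
have := @max_poly_roots _ P s Pn0; rewrite size_map size_iota ltnn => h.
suff : false by []; apply: h.
  apply/allP => _ /mapP[k _ ->]; rewrite /root PE; apply/eqP/H => i.
  rewrite mxE normrM gtr0_norm ?divr_gt0 // -!mulrA gtr_pMr // ltr_pdivrMl //.
  rewrite mulr1 ltr_pdivrMl // (lt_le_trans (zM i)) //.
  by rewrite ler_peMl ?ler1n // ltW.
rewrite map_inj_uniq ?iota_uniq // => j k /(mulfI _) h'.
have /invr_inj/eqP : (j.+1%:R : R)^-1 = k.+1%:R^-1.
  by apply: h'; rewrite mulf_neq0 ?invr_eq0 ?gt_eqF.
by rewrite eqr_nat => /eqP[].
Qed.

End AffineExpansion.

(** * Exponents of the first variable *)

Section FirstExponents.
Context {R : realType} (n : nat).
Implicit Types (q : {set 'I_n.+1} -> R) (t : 'rV[R]_n).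

Lemma monomial_cons (a : R) t (al : {ffun 'I_n.+1 -> nat}) :
  monomial (cons_row a t) al =
  a ^+ al ord0 * \prod_(i < n) t 0 i ^+ al (lift ord0 i).
Proof.
by rewrite /monomial big_ord_recl cons_row0; under eq_bigr do rewrite cons_rowS.
Qed.

(** For a fixed small [t], the expansion regrouped by the exponent of the first variable and the
    binomial series of (u - s v)^(-l) are two power series in [s] with the same sum. Equality of
    their k-th coefficients gives 0 = u^(-l) negbin_k (v / u)^k, hence v = 0 and k != 0; an affine v
    vanishing near 0 is identically 0. *)
Lemma first_exponents (l : R) q c : 0 < l -> q finset.set0 = 0 ->
  has_power_series c (fun z => (1 - affine q z) `^ (- l)) ->
  forall k, (forall al : {ffun 'I_n.+1 -> nat}, al ord0 = k -> c al = 0) ->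
  (k != 0%N /\ forall t, affine (dcoef ord0 q) (cons_row 0 t) = 0).
Proof.
move=> l0 q0 /near_row0P[e1 e10 H1] k ck.
have [e2 e20 H2] := affine_terms_small q0.
pose e := Num.min e1 e2.
have e0 : 0 < e by rewrite lt_min e10 e20.
have [ee1 ee2] : e <= e1 /\ e <= e2 by rewrite !ge_min !lexx orbT.
have lt1 (z : 'rV[R]_n.+1) : (forall i, `|z 0 i| < e) -> `|affine q z| < 1.
  move=> ze; apply: le_lt_trans (H2 z _); first exact: ler_norm_sum.
  by move=> i; exact: lt_le_trans (ze i) ee2.
have main (t : 'rV[R]_n) : (forall i, `|t 0 i| < e) ->
    k != 0%N /\ affine (dcoef ord0 q) (cons_row 0 t) = 0.
  move=> te; set v := affine (dcoef ord0 q) (cons_row 0 t).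
  pose u := 1 - affine q (cons_row 0 t).
  have ce s : `|s| < e -> forall i, `|cons_row s t 0 i| < e.
    move=> se i; case: (unliftP ord0 i) => [j ->|->]; first by rewrite cons_rowS.
    by rewrite cons_row0.
  have qE s : 1 - affine q (cons_row s t) = u - s * v.
    by rewrite (affine_cons q 0) subr0 /u -/v; ring.
  have u0 : 0 < u.
    have := lt1 _ (ce 0 _); rewrite normr0 => /(_ e0); rewrite /u ltr_norml; lra.
  have sv s : `|s| < e -> s * v < u.
    by move=> /ce/lt1; have := qE s; rewrite ltr_norml; lra.
  have sumS s : `|s| < e ->
      signed_sum (fun al => c al * monomial (cons_row s t) al) ((u - s * v) `^ (- l)).
    move=> se; rewrite -qE; apply: H1 => i.
    exact: lt_le_trans (ce _ se i) ee1.
  pose s0 := e / 2.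
  have s00 : 0 < s0 by rewrite divr_gt0.
  have s0e : `|s0| < e by rewrite gtr0_norm // /s0; lra.
  have [y hy _] := signed_sum_regroup (fun al : {ffun 'I_n.+1 -> nat} => al ord0) (sumS s0 s0e).
  have yk : y k = 0.
    apply: signed_sum_unique (hy k) _.
    have := @signed_sum_finite_support R {ffun 'I_n.+1 -> nat} [::] (fun=> 0) isT (fun _ _ => erefl).
    rewrite big_nil; congr signed_sum; apply/funext => al.
    by case: ifPn => // /eqP /ck ->; rewrite mul0r.
  pose D j := y j / s0 ^+ j.
  (* The coefficients [D], computed at [s0], serve for every [s]: the terms with first exponent j
     scale by (s / s0)^j. *)
  have cvD s : `|s| < e -> pseries D s @ \oo --> (u - s * v) `^ (- l).
    move=> se; have [y' hy' hv] := signed_sum_regroup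
      (fun al : {ffun 'I_n.+1 -> nat} => al ord0) (sumS s se).
    suff -> : pseries D s = series y' by exact: signed_sum_nat hv.
    apply/funext => N; apply: eq_bigr => j _.
    apply: (signed_sum_unique _ (hy' j)) => /=.
    rewrite (_ : D j * s ^+ j = s ^+ j / s0 ^+ j * y j); last by rewrite /D; ring.
    have := signed_sumZ (s ^+ j / s0 ^+ j) (hy j); congr signed_sum.
    apply/funext => al; case: ifPn => [/eqP <-|_]; last by rewrite mulr0.
    rewrite !monomial_cons; field; rewrite expf_neq0 // gt_eqF //.
  pose B j := u `^ (- l) * negbin l j * (v / u) ^+ j.
  have cvB s : `|s| < e -> pseries B s @ \oo --> (u - s * v) `^ (- l).
    move=> se.
    have -> : pseries B s = (fun N => u `^ (- l) * pseries (negbin l) (s * v / u) N).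
      apply/funext => N; rewrite /pseries /series /= mulr_sumr.
      by apply: eq_bigr => j _; rewrite /B -!mulrA; congr (_ * (_ * _)); rewrite -exprMn [v / u * s]mulrC mulrA.
    have -> : u - s * v = u * (1 - s * v / u) by field; rewrite gt_eqF.
    have sv1 : s * v / u < 1 by rewrite ltr_pdivrMr // mul1r sv.
    have sv2 : - (s * v / u) < 1.
      rewrite -mulNr -mulNr ltr_pdivrMr // mul1r; apply: sv; by rewrite normrN.
    rewrite powRM ?ltW // ?subr_gt0 //; apply: cvgMl_tmp.
    by apply: cvg_negbin; rewrite // ltr_norml ltrNl sv1 sv2.
  have DB := pseries_inj e0 cvD cvB.
  have : B k = 0 by rewrite -DB /D yk mul0r.
  have nz : u `^ (- l) * negbin l k != 0.
    by rewrite mulf_neq0 // gt_eqF ?powR_gt0 ?negbin_gt0.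
  move=> /eqP; rewrite /B mulf_eq0 (negbTE nz) /= expf_eq0 mulf_eq0 invr_eq0 [u == 0]gt_eqF // orbF.
  by case/andP => k0 /eqP ->; rewrite -lt0n.
have z0 i : `|(0 : 'rV[R]_n) 0 i| < e by rewrite mxE normr0.
split; first by case: (main 0 z0).
have E t : affine (dcoef ord0 q) (cons_row 0 t) = affine (tail_coef (dcoef ord0 q)) t.
  by rewrite -(partial_cons q 0) partial_affine.
move=> t; rewrite E; apply: (affine_eq0 e0) => {}t te; rewrite -E.
by case: (main t te).
Qed.

Context (p : {set 'I_n.+1} -> R) (l : R) (l0 : 0 < l).

Let R0 : R_coef p finset.set0 = 0.
Proof. by rewrite /R_coef cards0. Qed.

(** Since an expansion exists, the default value of [xget] is never taken. *)
Lemma c_has_power_series :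
  has_power_series (c_ p l) (fun z => (1 - R_ p z) `^ (- l)).
Proof.
by apply: (@xgetPex _ (fun=> 0) [set c | has_power_series c _]);
   rewrite R_affine; exact: has_power_series_affine.
Qed.

Lemma not_I1 k : ~ I1 p l k ->
  k != 0%N /\ forall t, partial ord0 (R_ p) (cons_row 0 t) = 0.
Proof.
move=> nk; have := c_has_power_series; rewrite R_affine partial_affine.
move=> /(first_exponents l0 R0); apply => al alk.
by apply/eqP/negPn/negP => cal; apply: nk; exists al.
Qed.

Lemma G_expR t x : G_ p l (zfrak p t * x) = expR (zfrak p t * x).
Proof.
have [all|/existsNP[k /not_I1[_ v0]]] := pselect (forall k, I1 p l k).
  rewrite /G_ expRE; congr (limn _); apply/funext => N.
  rewrite /pseries /series /=; apply: eq_big => [k|k _]; last by rewrite mulrC.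
  by rewrite mem_set.
have -> : zfrak p t = 0 by rewrite /zfrak /B_ v0 mulr0 mul0r.
rewrite mul0r expR0 /G_; apply: cvg_lim => //; apply: cvg_near_cst.
exists 1%N => // -[|N] //= _; rewrite big_mkcond big_nat_recl //= mem_set; last first.
  by apply: contrapT => /not_I1[].
rewrite expr0 fact0 divr1 big1 ?addr0 // => i _.
by rewrite expr0n mul0r if_same.
Qed.

End FirstExponents.

(** * Laplace transforms on the line *)

Section ExpBounds.
Context {R : realType}.
Implicit Types u : R.

Lemma series_exp_coeff_cvg u : series (exp_coeff u) @ \oo --> expR u.
Proof. exact: is_cvg_series_exp_coeff. Qed.

Lemma series_exp_coeff_le u N : 0 <= u -> series (exp_coeff u) N <= expR u.
Proof.
move=> u0; apply: nondecreasing_cvgn_le; last exact: is_cvg_series_exp_coeff.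
by apply: nondecreasing_series => k _ _; exact: exp_coeff_ge0.
Qed.

Lemma expR_norm_le u : expR `|u| <= expR u + expR (- u).
Proof.
have [u0|u0] := leP 0 u; first by rewrite ger0_norm // lerDl expR_ge0.
by rewrite ltr0_norm // lerDr expR_ge0.
Qed.

(** A majorant independent of [N], integrable as soon as the transform is finite at two opposite
    points; it serves for dominated convergence. *)
Lemma norm_series_exp_coeff_le u N :
  `|series (exp_coeff u) N| <= expR u + expR (- u).
Proof.
rewrite (le_trans _ (expR_norm_le u)) // (le_trans _ (series_exp_coeff_le N (normr_ge0 u))) //.
rewrite (le_trans (ler_norm_sum _ _ _)) // ler_sum // => k _.
by rewrite /exp_coeff /= normrM normrX [`|_^-1|]ger0_norm.
Qed.

Lemma norm_exp_coeff_le u k : `|exp_coeff u k| <= expR u + expR (- u).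
Proof.
rewrite (le_trans _ (expR_norm_le u)) // (le_trans _ (series_exp_coeff_le k.+1 (normr_ge0 u))) //.
rewrite /series /= big_nat_recr //= normrM normrX [`|_^-1|]ger0_norm // lerDr.
by apply: sumr_ge0 => i _; rewrite exp_coeff_ge0.
Qed.

Lemma exp_coeffDN_ge0 u k : 0 <= exp_coeff u k + exp_coeff (- u) k.
Proof.
rewrite /exp_coeff /= -mulrDl mulr_ge0 // exprNn -signr_odd.
have [ok|ek] := boolP (odd k); first by rewrite expr1 mulN1r subrr.
by rewrite expr0 mul1r -mulr2n mulrn_wge0 // exprn_even_ge0.
Qed.

End ExpBounds.

Section Laplace.
Context d (T : measurableType d) (R : realType).
Variable m : {measure set T -> \bar R}.
Implicit Types (w y : T -> R) (a b l t s : R).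

(** The weight [w] has two uses: it absorbs the exponential factor when the origin is moved
    ([laplace_shift]), and it carries the other coordinates when a single one varies. *)
Definition laplace w y t : \bar R :=
  (\int[m]_x (w x * expR (- t * y x))%:E)%E.

Lemma laplace_shift w y s t :
  laplace (fun x => w x * expR (- s * y x)) y t = laplace w y (s + t).
Proof.
apply: eq_integral => x _; congr EFin.
by rewrite -mulrA -expRD; congr (_ * expR _); ring.
Qed.

Lemma laplace_opp w y t : laplace w (fun x => - y x) t = laplace w y (- t).
Proof. by apply: eq_integral => x _; rewrite mulrN -mulNr. Qed.

Lemma measurable_laplace w y t : measurable_fun [set: T] w -> measurable_fun [set: T] y ->
  measurable_fun [set: T] (fun x => @EFin R (w x * expR (- t * y x))).
Proof.
move=> mw my; apply/measurable_EFinP; apply: measurable_funM => //.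
by apply: measurableT_comp => //; apply: measurable_funM.
Qed.

Lemma laplace_ge0 w y t : (forall x, 0 < w x) -> (0 <= laplace w y t)%E.
Proof. by move=> w0; apply: integral_ge0 => x _; rewrite lee_fin mulr_ge0 ?expR_ge0 // ltW. Qed.

Section Moments.
Context (w y : T -> R).
Hypothesis mw : measurable_fun [set: T] w.
Hypothesis my : measurable_fun [set: T] y.
Hypothesis w0 : forall x, 0 < w x.

Lemma laplace_integrable t : (laplace w y t < +oo)%E ->
  m.-integrable [set: T] (fun x => (w x * expR (- t * y x))%:E).
Proof.
move=> h; apply/integrableP; split; first exact: measurable_laplace.
rewrite (_ : integral _ _ _ = laplace w y t) //; apply: eq_integral => x _.
by rewrite gee0_abs // lee_fin mulr_ge0 ?expR_ge0 // ltW.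
Qed.

Let dom t x := ((w x * expR (- t * y x))%:E + (w x * expR (- - t * y x))%:E)%E.

Let dom_integrable t : (laplace w y t < +oo)%E -> (laplace w y (- t) < +oo)%E ->
  m.-integrable [set: T] (dom t).
Proof. by move=> h1 h2; apply: integrableD => //; exact: laplace_integrable. Qed.

Let measurable_term t k :
  measurable_fun [set: T] (fun x => @EFin R (w x * exp_coeff (- t * y x) k)).
Proof.
apply/measurable_EFinP; apply: measurable_funM => //; apply: measurable_funM => //.
by apply: measurable_funX; apply: measurable_funM.
Qed.

Lemma exp_coeff_integrable t s k :
  (laplace w y t < +oo)%E -> (laplace w y (- t) < +oo)%E -> 0 < t ->
  m.-integrable [set: T] (fun x => (w x * exp_coeff (- s * y x) k)%:E).
Proof.
move=> h1 h2 t0.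
have e : (fun x => (w x * exp_coeff (- s * y x) k)%:E) =
    (fun x => ((s / t) ^+ k)%:E * (w x * exp_coeff (- t * y x) k)%:E)%E.
  apply/funext => x; rewrite -EFinM; congr EFin; rewrite /exp_coeff /=.
  rewrite (_ : - s * y x = s / t * (- t * y x)); last by field; rewrite gt_eqF.
  by rewrite exprMn; ring.
rewrite e; apply: integrableZl => //.
apply: le_integrable (dom_integrable h1 h2) => //.
move=> x _; rewrite /dom -EFinD lee_fin -mulrDr 2!normrM ler_wpM2l //.
by rewrite !mulNr opprK (le_trans (norm_exp_coeff_le _ _)) // opprK ler_norm.
Qed.

(* This is [(-1)^k / k!] times the k-th moment of y. *)
Definition moment k : R := fine (\int[m]_x (w x * exp_coeff (- 1 * y x) k)%:E)%E.

Section FiniteExponentialMoments.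
Context (t0 : R).
Hypothesis h1 : (laplace w y t0 < +oo)%E.
Hypothesis h2 : (laplace w y (- t0) < +oo)%E.
Hypothesis t00 : 0 < t0.

Lemma integral_series t N :
  (\int[m]_x (w x * series (exp_coeff (- t * y x)) N)%:E)%E =
  (pseries moment t N)%:E.
Proof.
have e x : (w x * series (exp_coeff (- t * y x)) N)%:E =
    (\sum_(0 <= k < N) (w x * exp_coeff (- t * y x) k)%:E)%E.
  by rewrite sumEFin mulr_sumr.
under eq_integral do rewrite e.
rewrite integral_sum // => [|k]; last exact: exp_coeff_integrable h1 h2 t00.
rewrite /pseries /series /= -sumEFin; apply: eq_bigr => k _.
have i1 := exp_coeff_integrable 1 k h1 h2 t00.
rewrite [RHS]EFinM /moment fineK ?integrable_fin_num // muleC -integralZl //.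
apply: eq_integral => x _; rewrite -EFinM; congr EFin; rewrite /exp_coeff /=.
rewrite (_ : - t * y x = t * (- 1 * y x)); last by ring.
by rewrite exprMn; ring.
Qed.

Lemma series_integrable t N :
  m.-integrable [set: T] (fun x => (w x * series (exp_coeff (- t * y x)) N)%:E).
Proof.
have -> : (fun x => (w x * series (exp_coeff (- t * y x)) N)%:E) =
    (fun x => \sum_(0 <= k < N) (w x * exp_coeff (- t * y x) k)%:E)%E.
  by apply/funext => x; rewrite sumEFin mulr_sumr.
by apply: integrable_sum => // k _; exact: exp_coeff_integrable h1 h2 t00.
Qed.

Lemma cvg_moments t : (laplace w y t < +oo)%E -> (laplace w y (- t) < +oo)%E ->
  pseries moment t @ \oo --> fine (laplace w y t).
Proof.
move=> ht hNt.
have ft : laplace w y t \is a fin_num by rewrite ge0_fin_numE // laplace_ge0.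
suff /fine_cvg : EFin \o pseries moment t @ \oo --> (fine (laplace w y t))%:E by [].
rewrite fineK //.
have -> : EFin \o pseries moment t =
    (fun N => \int[m]_x (w x * series (exp_coeff (- t * y x)) N)%:E)%E.
  by apply/funext => N; rewrite integral_series.
apply: (@dominated_cvg _ _ _ m setT measurableT _ _ (dom t)) => //.
- by move=> N; exact: measurable_int (series_integrable t N).
- move=> x _; apply: cvg_EFin; first exact: nearW.
  by apply: cvgMl_tmp; exact: series_exp_coeff_cvg.
- exact: dom_integrable.
- move=> N x _; rewrite /dom -EFinD lee_fin -mulrDr normrM gtr0_norm //.
  by rewrite ler_pM2l // mulNr opprK (le_trans (norm_series_exp_coeff_le _ _)) // opprK.
Qed.

(* Only the even moments control the absolute ones, whence the hypothesis at
   both t and - t. *)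
Lemma moments_finite t (L L' : R) : pseries moment t @ \oo --> L ->
  pseries moment (- t) @ \oo --> L' ->
  (laplace w y t < +oo)%E /\ (laplace w y (- t) < +oo)%E.
Proof.
move=> cL cL'.
pose f N x := ((w x * series (exp_coeff (- t * y x)) N)%:E +
               (w x * series (exp_coeff (- - t * y x)) N)%:E)%E.
have mf N : measurable_fun [set: T] (f N).
  by apply: emeasurable_funD; exact: measurable_int (series_integrable _ N).
have f0 N x : setT x -> (0 <= f N x)%E.
  move=> _; rewrite /f -EFinD lee_fin -mulrDr mulr_ge0 //; first exact: ltW.
  rewrite /series /= -big_split sumr_ge0 // => k _.
  by rewrite [- - t * y x]mulNr; exact: exp_coeffDN_ge0.
(* Fatou's lemma bounds the sum of the transforms at t and - t by the limit L + L' of the integrated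
   partial sums. *)
have := fatou m measurableT mf f0.
have -> : (\int[m]_x limn_einf (f^~ x))%E = (\int[m]_x dom t x)%E.
  apply: eq_integral => x _; apply: (fst (cvg_limn_einf_sup _)).
  rewrite /dom -EFinD; apply: cvg_EFin; first exact: nearW.
  rewrite /f /=; apply: cvgD; apply: cvgMl_tmp; exact: series_exp_coeff_cvg.
have -> : limn_einf (fun N => \int[m]_x f N x)%E = (L + L')%:E.
  apply: (fst (cvg_limn_einf_sup _)).
  have -> : (fun N => \int[m]_x f N x)%E =
            EFin \o (pseries moment t \+ pseries moment (- t)).
    apply/funext => N /=; rewrite EFinD -!integral_series -integralD //;
      exact: series_integrable.
  by apply: cvg_EFin; [exact: nearW|exact: cvgD].
rewrite ge0_integralD //; first last.
- exact: measurable_laplace.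
- by move=> x _; rewrite lee_fin mulr_ge0 ?expR_ge0 // ltW.
- exact: measurable_laplace.
- by move=> x _; rewrite lee_fin mulr_ge0 ?expR_ge0 // ltW.
move=> h; split; apply: le_lt_trans (ltry (L + L')); apply: le_trans h.
- by rewrite leeDl // laplace_ge0.
- by rewrite leeDr // laplace_ge0.
Qed.

End FiniteExponentialMoments.
End Moments.
End Laplace.

(** * Transforms that are powers of an affine function *)

Section GammaTransform.
Context d (T : measurableType d) (R : realType).
Variable m : {measure set T -> \bar R}.
Implicit Types (w y : T -> R) (a b l t s : R).

Lemma cvg_negbin_affine a b l t : 0 < l -> 0 < a -> `|b * t| < a ->
  pseries (fun k => a `^ (- l) * negbin l k * (- b / a) ^+ k) t @ \oo -->
  (a + b * t) `^ (- l).
Proof.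
move=> l0 a0 bt.
have a_n0 : a != 0 by rewrite gt_eqF.
have -> : pseries (fun k => a `^ (- l) * negbin l k * (- b / a) ^+ k) t =
    (fun N => a `^ (- l) * pseries (negbin l) (- b / a * t) N).
  apply/funext => N; rewrite /pseries /series /= mulr_sumr.
  by apply: eq_bigr => j _; rewrite [in RHS]exprMn !mulrA.
have x1 : `|- b / a * t| < 1.
  rewrite (_ : - b / a * t = - (b * t / a)); last by field.
  by rewrite normrN normrM normfV (gtr0_norm a0) ltr_pdivrMr // mul1r.
have -> : a + b * t = a * (1 - (- b / a * t)) by field.
rewrite powRM ?ltW // ?subr_gt0; last by move: x1; rewrite ltr_norml => /andP[].
by apply: cvgMl_tmp; exact: cvg_negbin.
Qed.

(** Near 0 the moments are identified by uniqueness of power series. The binomial series converges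
    for |b t| < a; applied at both t and - t it yields finiteness of the transform there, and only
    then can the moment series be summed to it. *)
Lemma laplace_gamma_disc w y a b l e :
  measurable_fun [set: T] w -> measurable_fun [set: T] y -> (forall x, 0 < w x) ->
  0 < l -> 0 < a -> 0 < e ->
  (forall t, `|t| < e -> laplace m w y t = ((a + b * t) `^ (- l))%:E) ->
  forall t, `|b * t| < a -> laplace m w y t = ((a + b * t) `^ (- l))%:E.
Proof.
move=> mw my w0 l0 a0 e0 H t bt.
(* Below [r] both the assumed formula and its binomial expansion hold; 1 + |b| replaces |b|, which
   may be 0. *)
pose r := Num.min e (a / (1 + `|b|)).
have b1 : 0 < 1 + `|b| by rewrite ltr_pwDl.
have r0 : 0 < r by rewrite lt_min e0 divr_gt0.
have rP s : `|s| < r -> `|s| < e /\ `|b * s| < a.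
  rewrite lt_min => /andP[? h]; split => //; rewrite normrM.
  move: h; rewrite ltr_pdivlMr // mulrDr mulr1 mulrC => h.
  by rewrite (le_lt_trans _ h) // lerDr.
have h1 : (laplace m w y (r / 2) < +oo)%E.
  by rewrite H ?ltry // gtr0_norm ?divr_gt0 // (lt_le_trans (_ : _ < r)) ?ge_min ?lexx //; lra.
have h2 : (laplace m w y (- (r / 2)) < +oo)%E.
  by rewrite H ?ltry // normrN gtr0_norm ?divr_gt0 // (lt_le_trans (_ : _ < r)) ?ge_min ?lexx //; lra.
have r20 : 0 < r / 2 by rewrite divr_gt0.
have mE : moment m w y = (fun k => a `^ (- l) * negbin l k * (- b / a) ^+ k).
  apply: (pseries_inj (f := fun s => (a + b * s) `^ (- l)) r0) => s sr.
    have [se _] := rP _ sr.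
    have Fs : (laplace m w y s < +oo)%E by rewrite H ?ltry.
    have FNs : (laplace m w y (- s) < +oo)%E by rewrite H ?normrN ?ltry.
    by have := cvg_moments mw my w0 h1 h2 r20 Fs FNs; rewrite H.
  by have [_ bs] := rP _ sr; exact: cvg_negbin_affine.
have ct : pseries (moment m w y) t @ \oo --> (a + b * t) `^ (- l).
  by rewrite mE; exact: cvg_negbin_affine.
have cNt : pseries (moment m w y) (- t) @ \oo --> (a + b * - t) `^ (- l).
  by rewrite mE; apply: cvg_negbin_affine => //; rewrite mulrN normrN.
have [f1 f2] := moments_finite mw my w0 h1 h2 r20 ct cNt.
have ct' := cvg_moments mw my w0 h1 h2 r20 f1 f2.
have -> : (a + b * t) `^ (- l) = fine (laplace m w y t) by exact: cvg_unique ct ct'.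
by rewrite fineK // ge0_fin_numE // laplace_ge0.
Qed.

(* Recentring at t / 2 doubles the distance reached from 0. *)
Lemma laplace_gamma w y a b l e :
  measurable_fun [set: T] w -> measurable_fun [set: T] y -> (forall x, 0 < w x) ->
  0 < l -> 0 < a -> 0 < e ->
  (forall t, `|t| < e -> laplace m w y t = ((a + b * t) `^ (- l))%:E) ->
  forall t, 0 < a + b * t -> laplace m w y t = ((a + b * t) `^ (- l))%:E.
Proof.
move=> mw my w0 l0 a0 e0 H.
have key k : forall t, 0 < a + b * t -> `|b * t| < 2 ^+ k * a ->
    laplace m w y t = ((a + b * t) `^ (- l))%:E.
  elim: k => [|k IH] t abt; first by rewrite expr0 mul1r; exact: laplace_gamma_disc H _.
  rewrite exprS -mulrA => bt.
  pose s := t / 2; pose a' := a + b * s.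
  have bs : `|b * s| < 2 ^+ k * a.
    by rewrite /s mulrA normrM [`|2^-1|]gtr0_norm // ltr_pdivrMr // [ltRHS]mulrC.
  have a'0 : 0 < a' by rewrite /a' /s; lra.
  (* For |h| < e' the point s + h satisfies both conditions of the induction hypothesis. *)
  pose e' := Num.min a' (2 ^+ k * a - `|b * s|) / (1 + `|b|).
  have b1 : 0 < 1 + `|b| by rewrite ltr_pwDl.
  have e'0 : 0 < e' by rewrite divr_gt0 // lt_min a'0 subr_gt0.
  have ew x : 0 < w x * expR (- s * y x) by rewrite mulr_gt0 ?expR_gt0.
  have mw' : measurable_fun [set: T] (fun x => w x * expR (- s * y x)).
    apply: measurable_funM => //; apply: measurableT_comp => //.
    exact: measurable_funM.
  have H' h : `|h| < e' -> laplace m (fun x => w x * expR (- s * y x)) y h =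
      ((a' + b * h) `^ (- l))%:E.
    rewrite ltr_pdivlMr // => he.
    have bh : `|b * h| < Num.min a' (2 ^+ k * a - `|b * s|).
      by rewrite normrM (le_lt_trans _ he) // mulrC ler_wpM2l // lerDr.
    move: bh; rewrite lt_min ltr_norml => /andP[/andP[bh1 bh2] bh3].
    rewrite laplace_shift IH; first by congr ((_ `^ _)%:E); rewrite /a'; ring.
      by rewrite mulrDr addrA -/a'; lra.
    by rewrite mulrDr (le_lt_trans (ler_normD _ _)) // -ltrBrDl.
  (* The disc around [s] reaches [t]: |b s| < a' because a' - b s = a and a' + b s = a + b t are
     both positive. *)
  have -> : t = s + s by rewrite /s; lra.
  rewrite -laplace_shift (laplace_gamma_disc mw' my ew l0 a'0 e'0 H').
    by congr ((_ `^ _)%:E); rewrite /a'; ring.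
  by rewrite /a' /s ltr_norml; lra.
move=> t abt.
have [k hk] : exists k, `|b * t| < 2 ^+ k * a.
  exists (Num.truncn (`|b * t| / a)).+1; rewrite -ltr_pdivrMr //.
  apply: (lt_trans (truncnS_gt _)); rewrite -natrX ltr_nat.
  exact: ltn_expl.
exact: key hk.
Qed.

(** With b <= 0 the transform at - N stays below a^(-l), while on y > 0 its integrand is at least N
    w y. Hence the integral of w y over y > 0 is at most a^(-l) / N for all N > 0. *)
Lemma laplace_gamma_nonpos w y a b l e :
  measurable_fun [set: T] w -> measurable_fun [set: T] y -> (forall x, 0 < w x) ->
  0 < l -> 0 < a -> 0 < e -> b <= 0 ->
  (forall t, `|t| < e -> laplace m w y t = ((a + b * t) `^ (- l))%:E) ->
  {ae m, forall x, y x <= 0}.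
Proof.
move=> mw my w0 l0 a0 e0 b0 H.
pose A := [set x | 0 < y x].
have mA : measurable A.
  rewrite (_ : A = y @^-1` `]0, +oo[); last first.
    by apply/seteqP; split=> x; rewrite /A /= in_itv /= andbT.
  by rewrite -[X in measurable X]setTI; exact: my.
pose I := (\int[m]_(x in A) (w x * y x)%:E)%E.
have mwy : measurable_fun A (fun x => @EFin R (w x * y x)).
  by apply: measurable_funTS; apply/measurable_EFinP; exact: measurable_funM.
have wy0 x : A x -> (0 <= (w x * y x)%:E)%E.
  by move=> Ax; rewrite lee_fin mulr_ge0 // ltW.
have bound (N : nat) : (N%:R%:E * I <= (a `^ (- l))%:E)%E.
  have FN := laplace_gamma mw my w0 l0 a0 e0 H (t := - N%:R).
  have abN : a <= a + b * - N%:R by rewrite mulrN lerDl oppr_ge0 mulr_le0_ge0.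
  apply: (@le_trans _ _ (laplace m w y (- N%:R))); last first.
    have abN0 := lt_le_trans a0 abN.
    rewrite FN //.
    rewrite lee_fin !powRN lef_pV2 ?posrE ?powR_gt0 //.
    by apply: ge0_ler_powR abN; rewrite ?nnegrE; exact: ltW.
  rewrite /I -ge0_integralZl_EFin //.
  apply: (@le_trans _ _ (\int[m]_(x in A) (w x * expR (- - N%:R * y x))%:E)%E).
    apply: ge0_le_integral => //.
    - by move=> x Ax; rewrite mule_ge0 ?wy0 // lee_fin.
    - exact: measurable_funeM.
    - by apply: measurable_funTS; exact: measurable_laplace.
    - move=> x Ax; rewrite -EFinM lee_fin mulrCA ler_wpM2l ?(ltW (w0 x)) //.
      by rewrite opprK (le_trans _ (expR_ge1Dx _)) // lerDr.
  apply: ge0_subset_integral => //; first exact: measurable_laplace.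
  by move=> x _; rewrite lee_fin mulr_ge0 ?expR_ge0 // ltW.
have I0 : I = 0%E.
  have Ige0 : (0 <= I)%E by exact: integral_ge0.
  apply/eqP; rewrite eq_le Ige0 andbT leNgt; apply/negP => Ipos.
  have Ifin : I \is a fin_num.
    by rewrite ge0_fin_numE // (le_lt_trans _ (ltry (a `^ (- l)))) // -[I]mul1e; exact: (bound 1%N).
  pose i := fine I.
  have i0 : 0 < i by rewrite fine_gt0 // Ipos ltey_eq Ifin.
  have := bound (Num.truncn (a `^ (- l) / i)).+1.
  rewrite -(fineK Ifin) -/i -EFinM lee_fin leNgt => /negP; apply.
  by rewrite -ltr_pdivrMr //; exact: truncnS_gt.
have [h _] := ae_eq_integral_abs m mA mwy.
have [|N [mN N0 subN]] := h.
  by rewrite -I0; apply: eq_integral => x /set_mem Ax; rewrite gee0_abs // wy0.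
exists N; split=> // x /= /negP; rewrite -ltNge => yx; apply: subN => /= /(_ yx)/eqP.
by rewrite eqe mulf_eq0 !gt_eqF.
Qed.

(** With b > 0 the transform tends to 0 at +oo, while on y <= 0 its integrand stays at least [w].
    The value y = 0 is excluded too. *)
Lemma laplace_gamma_pos w y a b l e :
  measurable_fun [set: T] w -> measurable_fun [set: T] y -> (forall x, 0 < w x) ->
  0 < l -> 0 < a -> 0 < e -> 0 < b ->
  (forall t, `|t| < e -> laplace m w y t = ((a + b * t) `^ (- l))%:E) ->
  {ae m, forall x, 0 < y x}.
Proof.
move=> mw my w0 l0 a0 e0 b0 H.
pose A := [set x | y x <= 0].
have mA : measurable A.
  rewrite (_ : A = y @^-1` `]-oo, 0]); last first.
    by apply/seteqP; split=> x; rewrite /A /= in_itv.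
  by rewrite -[X in measurable X]setTI; exact: my.
pose I := (\int[m]_(x in A) (w x)%:E)%E.
have mwA : measurable_fun A (fun x => @EFin R (w x)).
  by apply: measurable_funTS; apply/measurable_EFinP.
have bound t : 0 <= t -> (I <= ((a + b * t) `^ (- l))%:E)%E.
  move=> t0; have abt : 0 < a + b * t by rewrite ltr_wpDr // mulr_ge0 // ltW.
  rewrite -(laplace_gamma mw my w0 l0 a0 e0 H abt).
  apply: (@le_trans _ _ (\int[m]_(x in A) (w x * expR (- t * y x))%:E)%E).
    apply: ge0_le_integral => //.
    - by move=> x _; rewrite lee_fin ltW.
    - by apply: measurable_funTS; exact: measurable_laplace.
    - move=> x Ax; rewrite lee_fin ler_peMr ?(ltW (w0 x)) //.
      by rewrite (le_trans _ (expR_ge1Dx _)) // lerDl mulNr oppr_ge0 mulr_ge0_le0.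
  apply: ge0_subset_integral => //; first exact: measurable_laplace.
  by move=> x _; rewrite lee_fin mulr_ge0 ?expR_ge0 // ltW.
have I0 : I = 0%E.
  have Ige0 : (0 <= I)%E by apply: integral_ge0 => x _; rewrite lee_fin ltW.
  apply/eqP; rewrite eq_le Ige0 andbT.
  apply/lee_addgt0Pr => e1 e10; rewrite add0e.
  (* The first bound makes (z - a) / b nonnegative, the second makes z^(-l) at most [e1]. *)
  pose z := Num.max (a + b) (e1 `^ (- l^-1)).
  have zab : a + b <= z by rewrite le_max lexx.
  have z0 : 0 < z by rewrite (lt_le_trans _ zab) // addr_gt0.
  apply: (le_trans (bound ((z - a) / b) _)).
    by rewrite divr_ge0 ?(ltW b0) // subr_ge0 (le_trans _ zab) // lerDl ltW.
  rewrite lee_fin (_ : a + b * _ = z); last by field; rewrite gt_eqF.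
  have -> : e1 = (e1 `^ (- l^-1)) `^ (- l).
    by rewrite -powRrM mulrNN mulVf ?gt_eqF // powRr1 // ltW.
  rewrite !powRN lef_pV2 ?posrE ?powR_gt0 //; last by rewrite invr_gt0 powR_gt0.
  apply: ge0_ler_powR; rewrite ?nnegrE ?(ltW l0) ?(ltW z0) //.
    by rewrite invr_ge0 powR_ge0.
  by rewrite -powRN le_max lexx orbT.
have [h _] := ae_eq_integral_abs m mA mwA.
have [|N [mN N0 subN]] := h.
  by rewrite -I0; apply: eq_integral => x _; rewrite gee0_abs // lee_fin ltW.
exists N; split=> // x /= /negP; rewrite -leNgt => yx; apply: subN => /= /(_ yx)/eqP.
by rewrite eqe gt_eqF.
Qed.

Lemma laplace_nincr w y s t : measurable_fun [set: T] w ->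
  measurable_fun [set: T] y -> (forall x, 0 < w x) ->
  {ae m, forall x, 0 <= y x} -> s <= t ->
  (laplace m w y t <= laplace m w y s)%E.
Proof.
move=> mw my w0 y0 st; apply: ae_ge0_le_integral => //.
- by move=> x _; rewrite lee_fin mulr_ge0 ?expR_ge0 // ltW.
- exact: measurable_laplace.
- by move=> x _; rewrite lee_fin mulr_ge0 ?expR_ge0 // ltW.
- exact: measurable_laplace.
- move: y0; apply: filterS => x yx _; rewrite lee_fin ler_pM2l // ler_expR.
  by rewrite ler_wpM2r // lerN2.
Qed.

(** For y >= 0 the transform is nonincreasing, which forces b >= 0. If a + b s vanished or were
    negative somewhere above [s0], the transform would be unbounded to the right of [s0], although
    its value at [s0] bounds it. *)
Lemma laplace_gamma_extend w y a b l u v s0 :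
  measurable_fun [set: T] w -> measurable_fun [set: T] y -> (forall x, 0 < w x) ->
  {ae m, forall x, 0 <= y x} -> 0 < l -> u < v ->
  (forall s, u < s < v -> 0 < a + b * s /\
     laplace m w y s = ((a + b * s) `^ (- l))%:E) ->
  (laplace m w y s0 < +oo)%E ->
  forall s, s0 <= s -> 0 < a + b * s /\
     laplace m w y s = ((a + b * s) `^ (- l))%:E.
Proof.
move=> mw my w0 y0 l0 uv H fin0.
pose c := (u + v) / 2; pose a' := a + b * c.
have cuv : u < c < v by rewrite /c; lra.
have a'0 : 0 < a' by have [] := H c cuv.
pose e := (v - u) / 2.
have e0 : 0 < e by rewrite /e; lra.
have mw' : measurable_fun [set: T] (fun x => w x * expR (- c * y x)).
  apply: measurable_funM => //; apply: measurableT_comp => //.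
  exact: measurable_funM.
have w'0 x : 0 < w x * expR (- c * y x) by rewrite mulr_gt0 ?expR_gt0.
have H' t : 0 < a + b * t -> laplace m w y t = ((a + b * t) `^ (- l))%:E.
  move=> abt; have -> : t = c + (t - c) by ring.
  rewrite -laplace_shift (laplace_gamma (b := b) mw' my w'0 l0 a'0 e0).
  - by congr ((_ `^ _)%:E); rewrite /a'; ring.
  - move=> h; rewrite ltr_norml laplace_shift => he.
    have [|_ ->] := H (c + h); first by rewrite /c; move: he; rewrite /e; lra.
    by congr ((_ `^ _)%:E); rewrite /a'; ring.
  - by rewrite (_ : _ + _ = a + b * t) // /a'; ring.
have powN_mono x z : 0 < x -> 0 < z -> x `^ (- l) <= z `^ (- l) -> z <= x.
  move=> x0 z0; rewrite !powRN lef_pV2 ?posrE ?powR_gt0 //.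
  rewrite leNgt; apply: contraNle => /(gt0_ltr_powR l0); apply; rewrite nnegrE ltW //.
have b0 : 0 <= b.
  pose t := c + e / 2.
  have [abt Ft] : 0 < a + b * t /\ laplace m w y t = ((a + b * t) `^ (- l))%:E.
    by apply: H; rewrite /t /c /e; lra.
  have ct : c <= t by rewrite /t; lra.
  have := laplace_nincr mw my w0 y0 ct; rewrite Ft H' // lee_fin.
  move=> /(powN_mono _ _ abt a'0); rewrite /t /a' => h.
  have : 0 <= b * (e / 2) by lra.
  by rewrite pmulr_lge0 // divr_gt0.
suff pos s : s0 <= s -> 0 < a + b * s by move=> s ss; split; [exact: pos|apply: H'; exact: pos].
move=> ss; rewrite ltNge; apply/negP => abs.
have bp : 0 < b.
  rewrite lt_neqAle b0 andbT eq_sym; apply/eqP => b00.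
  by move: abs a'0; rewrite /a' b00 !mul0r addr0; lra.
have ffin : laplace m w y s0 \is a fin_num by rewrite ge0_fin_numE // laplace_ge0.
(* At the point [t] where a + b t = z the transform equals K, one more than its value at [s0],
   although s0 <= t. *)
pose K := fine (laplace m w y s0) + 1.
have K0 : 0 < K by rewrite ltr_wpDl // fine_ge0 // laplace_ge0.
pose z := K `^ (- l^-1).
have z0 : 0 < z by rewrite powR_gt0.
pose t := (z - a) / b.
have abt : a + b * t = z by rewrite /t; field; rewrite gt_eqF.
have s0t : s0 <= t.
  by rewrite /t ler_pdivlMr // mulrC (le_trans (ler_wpM2l b0 ss)) // lerBrDl (le_trans abs) // ltW.
have := laplace_nincr mw my w0 y0 s0t.
rewrite H' ?abt // -(fineK ffin) lee_fin -powRrM mulrNN mulVf ?gt_eqF //.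
by rewrite powRr1 ?(ltW K0) // /K gerDl ler10.
Qed.

End GammaTransform.

(** * Continuation to the orthant *)

Section AffinePositivity.
Context {R : realType} (n : nat).
Implicit Types (q : {set 'I_n} -> R) (x : 'rV[R]_n).

Definition row_update x (k : 'I_n) (s : R) : 'rV[R]_n :=
  \row_i if i == k then s else x 0 i.

Lemma row_update_same x k s : row_update x k s 0 k = s.
Proof. by rewrite mxE eqxx. Qed.

Lemma row_update_other x k s i : i != k -> row_update x k s 0 i = x 0 i.
Proof. by rewrite mxE => /negbTE ->. Qed.

Lemma row_update_id x k : row_update x k (x 0 k) = x.
Proof. by apply/rowP => i; rewrite mxE; case: eqP => // ->. Qed.

Lemma affine_row_update q x k s :
  affine q (row_update x k s) = affine q (row_update x k 0) + affine (dcoef k q) x * s.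
Proof.
have -> : affine (dcoef k q) x = affine (dcoef k q) (row_update x k 0).
  rewrite [RHS](@affine_update _ _ k _ x) => [|j jk]; last by rewrite row_update_other.
  rewrite [X in _ = _ + _ * X](_ : _ = 0) ?mulr0 ?addr0 //.
  rewrite /affine big1 // => S _; rewrite /dcoef.
  by case: ifP => _; rewrite ?finset.setU11 mul0r.
rewrite (@affine_update _ _ k _ (row_update x k 0)) ?row_update_same ?subr0 ?[s * _]mulrC // => j jk.
by rewrite !row_update_other.
Qed.

Lemma affine0 q : affine q 0 = q finset.set0.
Proof.
rewrite /affine (bigD1 finset.set0) //= big_set0 mulr1 big1 ?addr0 // => T T0.
have [i iT] := set0Pn _ T0.
by rewrite (bigD1 i) //= mxE mul0r mulr0.
Qed.

(** Nonnegativity on the orthant passes to each partial derivative, since a negative slope would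
    make the polynomial negative far along that axis; differentiating along T leaves q T as the
    value at 0. *)
Lemma affine_nonneg_coef q :
  (forall x, (forall i, 0 <= x 0 i) -> 0 <= affine q x) -> forall T, 0 <= q T.
Proof.
move=> q0 T; elim: {T}#|T| {-2}T (erefl #|T|) q q0 => [|N IH] T TN q q0.
  have /eqP := TN; rewrite cards_eq0 => /eqP ->.
  by rewrite -affine0; apply: q0 => i; rewrite mxE.
have [i iT] : exists i, i \in T by apply/set0Pn; rewrite -card_gt0 TN.
have -> : q T = dcoef i q (T :\ i)%SET.
  by rewrite /dcoef !inE eqxx /= finset.setD1K.
apply: IH; first by have := cardsD1 i T; rewrite iT TN add1n => -[].
move=> x x0; rewrite leNgt; apply/negP => D0.
pose A := affine q (row_update x i 0).
have A0 : 0 <= A.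
  by apply: q0 => j; rewrite mxE; case: ifP.
(* Chosen so that the polynomial takes the value -1. *)
pose s := (A + 1) / - affine (dcoef i q) x.
have s0 : 0 <= s by rewrite divr_ge0 ?addr_ge0 ?oppr_ge0 ?(ltW D0).
have : 0 <= affine q (row_update x i s) by apply: q0 => j; rewrite mxE; case: ifP.
rewrite affine_row_update -/A (_ : _ * s = - (A + 1)); first by lra.
by rewrite /s; field; rewrite lt_eqF.
Qed.

End AffinePositivity.

(** * Continuation one coordinate at a time *)

Section MultivariateLaplace.
Context d (T : measurableType d) (R : realType) (n : nat).
Variable m : {measure set T -> \bar R}.
Implicit Types (X : 'I_n -> T -> R) (x : 'rV[R]_n) (p : {set 'I_n} -> R) (l e : R).

Definition mlaplace X x : \bar R :=
  (\int[m]_w (expR (- \sum_i x 0 i * X i w))%:E)%E.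

Definition mgamma_at X p l x : Prop :=
  0 < affine p x /\ mlaplace X x = (affine p x `^ (- l))%:E.

Definition weight X x (k : 'I_n) : T -> R :=
  fun w => expR (- \sum_(i | i != k) x 0 i * X i w).

Lemma weight_gt0 X x k w : 0 < weight X x k w.
Proof. exact: expR_gt0. Qed.

Lemma measurable_weight X x k : (forall i, measurable_fun [set: T] (X i)) ->
  measurable_fun [set: T] (weight X x k).
Proof.
move=> mX; apply: measurableT_comp => //; apply: measurableT_comp => //.
rewrite (_ : (fun w => _) = (fun w => \sum_i if i != k then x 0 i * X i w else 0)).
  have mt i : measurable_fun [set: T] (fun w => if i != k then x 0 i * X i w else 0 : R).
    by case: (i != k) => //; exact: measurable_funM.
  exact: measurable_sum mt.
by apply/funext => w; rewrite big_mkcond.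
Qed.

Lemma measurable_mlaplace X x : (forall i, measurable_fun [set: T] (X i)) ->
  measurable_fun [set: T] (fun w => @EFin R (expR (- \sum_i x 0 i * X i w))).
Proof.
move=> mX; apply/measurable_EFinP; apply: measurableT_comp => //.
apply: measurableT_comp => //; apply: measurable_sum => i.
exact: measurable_funM.
Qed.

Lemma mlaplace_row_update X x k s :
  mlaplace X (row_update x k s) = laplace m (weight X x k) (X k) s.
Proof.
apply: eq_integral => w _; congr EFin; rewrite /weight -expRD; congr expR.
rewrite (bigD1 k) //= row_update_same opprD addrC mulNr; congr (- _ + _).
by apply: eq_bigr => i ik; rewrite row_update_other.
Qed.

Lemma mlaplace_nincr X x x' : (forall i, measurable_fun [set: T] (X i)) ->
  (forall i, {ae m, forall w, 0 <= X i w}) ->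
  (forall i, x 0 i <= x' 0 i) -> (mlaplace X x' <= mlaplace X x)%E.
Proof.
move=> mX X0 xx'; apply: ae_ge0_le_integral => //.
- exact: measurable_mlaplace.
- exact: measurable_mlaplace.
- have : {ae m, forall w, forall i, 0 <= X i w} by exact: filter_forall.
  apply: filterS => w Xw _.
  by rewrite lee_fin ler_expR lerN2 ler_sum // => i _; rewrite ler_wpM2r.
Qed.

(* The coordinates are moved from [A i] to [C i] one at a time; along each of
   them P is affine, so that the one-variable extension applies. *)
Lemma mgamma_at_extend X p l (A C : 'I_n -> set R) (lo u v : 'rV[R]_n) :
  0 < l -> (forall i, measurable_fun [set: T] (X i)) ->
  (forall i, {ae m, forall w, 0 <= X i w}) ->
  (forall i, u 0 i < v 0 i) ->
  (forall i s, u 0 i < s < v 0 i -> A i s) ->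
  (forall i s, A i s \/ C i s -> lo 0 i <= s) ->
  (mlaplace X lo < +oo)%E ->
  (forall x, (forall i, A i (x 0 i)) -> mgamma_at X p l x) ->
  forall x, (forall i, C i (x 0 i)) -> mgamma_at X p l x.
Proof.
move=> l0 mX X0 uv uvA loAC finlo HA x Cx.
suff H (j : nat) : (j <= n)%N -> forall x : 'rV[R]_n,
    (forall i : 'I_n, if (i < j)%N then C i (x 0 i) else A i (x 0 i)) ->
    mgamma_at X p l x.
  by apply: (H n (leqnn n)) => i; rewrite ltn_ord.
elim: j => [_|j IH jn] {x Cx}x; first exact: HA.
move=> Hx; pose k := Ordinal jn.
have Hu s : A k s -> forall i : 'I_n,
    if (i < j)%N then C i (row_update x k s 0 i) else A i (row_update x k s 0 i).
  move=> As i; have [->|ik] := eqVneq i k; first by rewrite ltnn row_update_same.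
  rewrite row_update_other //; have := Hx i; rewrite ltnS leq_eqVlt.
  by have /negbTE -> : (i : nat) != j by apply: contraNneq ik => e; apply/eqP/val_inj.
(* Lowering all coordinates to [lo] can only increase the transform, which is finite there. *)
have fin : (laplace m (weight X x k) (X k) (lo 0%R k) < +oo)%E.
  rewrite -mlaplace_row_update (le_lt_trans _ finlo) //; apply: mlaplace_nincr => // i.
  have [->|ik] := eqVneq i k; first by rewrite row_update_same.
  rewrite row_update_other //; apply: loAC; have := Hx i; case: ifP => _; tauto.
have lox : lo 0 k <= x 0 k.
  by apply: loAC; right; have := Hx k; rewrite ltnSn.
have key s : u 0 k < s < v 0 k ->
    0 < affine p (row_update x k 0) + affine (dcoef k p) x * s /\
    laplace m (weight X x k) (X k) s =
     ((affine p (row_update x k 0) + affine (dcoef k p) x * s) `^ (- l))%:E.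
  move=> /uvA As; rewrite -affine_row_update -mlaplace_row_update.
  exact: IH (ltnW jn) _ (Hu _ As).
have := laplace_gamma_extend (measurable_weight _ _ mX) (mX k)
  (weight_gt0 _ _ _) (X0 k) l0 (uv k) key fin lox.
by rewrite -affine_row_update -mlaplace_row_update row_update_id.
Qed.

(** The sign of the slope of P along coordinate [k] decides: a nonpositive slope gives X_k <= 0, and
    a nonnegative one reduces to this case for - X_k. *)
Lemma mgamma_coord_sign X p l x e k : 0 < l -> 0 < e ->
  (forall i, measurable_fun [set: T] (X i)) ->
  (forall y : 'rV[R]_n, (forall i, `|y 0 i - x 0 i| < e) -> mgamma_at X p l y) ->
  {ae m, forall w, 0 <= X k w} \/ {ae m, forall w, 0 <= - X k w}.
Proof.
move=> l0 e0 mX H.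
pose w' z := weight X x k z * expR (- x 0 k * X k z).
have mw' : measurable_fun [set: T] w'.
  apply: measurable_funM; first exact: measurable_weight.
  by apply: measurableT_comp => //; exact: measurable_funM.
have w'0 z : 0 < w' z by rewrite mulr_gt0 ?expR_gt0 // weight_gt0.
pose b := affine (dcoef k p) x.
have x0 i : `|x 0 i - x 0 i| < e by rewrite subrr normr0.
have a0 : 0 < affine p x by have [] := H x x0.
have F h : `|h| < e -> laplace m w' (X k) h = ((affine p x + b * h) `^ (- l))%:E.
  move=> he; rewrite laplace_shift -mlaplace_row_update.
  have [|_ ->] := H (row_update x k (x 0 k + h)).
    move=> i; have [->|ik] := eqVneq i k; first by rewrite row_update_same addrAC subrr add0r.
    by rewrite row_update_other.
  by rewrite affine_row_update mulrDr addrA -affine_row_update row_update_id.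
have [b0|/ltW b0] := leP 0 b.
- left; have : {ae m, forall z, - X k z <= 0}.
    apply: (@laplace_gamma_nonpos _ _ _ m w' _ (affine p x) (- b) l e) => //.
    + exact: measurableT_comp.
    + by rewrite oppr_le0.
    + by move=> h he; rewrite laplace_opp F ?normrN // mulrN mulNr.
  by apply: filterS => z; rewrite oppr_le0.
- right; have : {ae m, forall z, X k z <= 0}.
    exact: (@laplace_gamma_nonpos _ _ _ m w' _ (affine p x) b l e).
  by apply: filterS => z; rewrite oppr_ge0.
Qed.

End MultivariateLaplace.

Section OrthantMgamma.
Context d (T : measurableType d) (R : realType) (n : nat).
Variable P : probability T R.
Implicit Types (X : 'I_n -> T -> R) (x : 'rV[R]_n) (p : {set 'I_n} -> R) (l e : R).

(** Two passes are needed, each starting above a corner where the transform is known to be finite: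
    from the cube at [x] to all points above both [x] and 0, with corner [x]; then down to the whole
    orthant, with corner 0, where the transform is the total mass. *)
Lemma mgamma_orthant_nonneg X p l x e : 0 < l -> 0 < e ->
  (forall i, measurable_fun [set: T] (X i)) ->
  (forall i, {ae P, forall w, 0 <= X i w}) ->
  (forall y : 'rV[R]_n, (forall i, `|y 0 i - x 0 i| < e) -> mgamma_at P X p l y) ->
  forall y : 'rV[R]_n, (forall i, 0 <= y 0 i) -> mgamma_at P X p l y.
Proof.
move=> l0 e0 mX X0 H.
pose A i := [set s | x 0 i <= s < x 0 i + e].
pose C i := [set s | x 0 i <= s /\ 0 <= s].
have H1 (y : 'rV[R]_n) : (forall i, C i (y 0 i)) -> mgamma_at P X p l y.
  apply: (@mgamma_at_extend _ _ _ _ P X p l A C x x (\row_i (x 0 i + e))) => //.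
  - by move=> i; rewrite mxE; lra.
  - by move=> i s; rewrite mxE /A /=; lra.
  - by move=> i s; rewrite /A /C /=; lra.
  - by have [|_ ->] := H x; rewrite ?ltry // => i; rewrite subrr normr0.
  - by move=> z Az; apply: H => i; have := Az i; rewrite /A /= ltr_norml; lra.
apply: (@mgamma_at_extend _ _ _ _ P X p l C (fun=> [set s | 0 <= s]) 0
   (\row_i Num.max (x 0 i) 0) (\row_i (Num.max (x 0 i) 0 + 1))) => //.
- by move=> i; rewrite !mxE; lra.
- move=> i s; rewrite !mxE /C /= => /andP[+ _]; rewrite gt_max => /andP[? ?].
  by split; exact: ltW.
- by move=> i s; rewrite mxE /C /=; tauto.
- rewrite /mlaplace (eq_integral (cst 1%E)).
    rewrite integral_cst // mul1e.
    by apply: (le_lt_trans (probability_le1 P measurableT)); exact: ltry.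
  by move=> z _; rewrite big1 ?oppr0 ?expR0 // => i _; rewrite mxE mul0r.
Qed.

(** Reflecting the nonpositive coordinates multiplies p_S by the product of the signs over S and
    reduces to nonnegative coordinates. The reflected coefficients are then nonnegative, and nonzero
    by hypothesis. *)
Lemma mgamma_orthant X p l x e : 0 < l -> 0 < e ->
  (forall S, p S != 0) ->
  (forall j : nat, (1 <= j <= n)%N -> 0 < p [set i : 'I_n | (i < j)%N]%SET) ->
  (forall i, measurable_fun [set: T] (X i)) ->
  (forall y : 'rV[R]_n, (forall i, `|y 0 i - x 0 i| < e) -> mgamma_at P X p l y) ->
  [/\ forall i, {ae P, forall w, 0 <= X i w},
      forall y : 'rV[R]_n, (forall i, 0 <= y 0 i) -> mgamma_at P X p l y &
      forall S, 0 < p S].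
Proof.
move=> l0 e0 pn0 pj mX H.
have /choice[eps epsP] : forall i, exists r : R,
    (r = 1 \/ r = -1) /\ {ae P, forall w, 0 <= r * X i w}.
  move=> i; have [h|h] := mgamma_coord_sign i l0 e0 mX H.
    by exists 1; split; [left|apply: filterS h => w; rewrite mul1r].
  by exists (-1); split; [right|apply: filterS h => w; rewrite mulN1r].
have eps2 i : eps i * eps i = 1.
  by case: (epsP i) => -[->|->] _; rewrite ?mulrNN mulr1.
pose flip (y : 'rV[R]_n) : 'rV[R]_n := \row_i (eps i * y 0 i).
pose q S := p S * \prod_(i in S) eps i.
have qE y : affine q y = affine p (flip y).
  apply: eq_bigr => S _; rewrite /q -mulrA -big_split; congr (_ * _).
  by apply: eq_bigr => i _; rewrite mxE.
have LE y : mlaplace P (fun i w => eps i * X i w) y = mlaplace P X (flip y).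
  apply: eq_integral => w _; congr (expR (- _))%:E; apply: eq_bigr => i _.
  by rewrite mxE mulrCA mulrA.
have orth (y : 'rV[R]_n) : (forall i, 0 <= y 0 i) -> mgamma_at P (fun i w => eps i * X i w) q l y.
  apply: (@mgamma_orthant_nonneg _ q l (flip x) e) => //.
  - by move=> i; exact: measurable_funM.
  - by move=> i; case: (epsP i).
  - move=> z Hz; rewrite /mgamma_at qE LE; apply: H => i.
    have := Hz i; rewrite !mxE.
    have -> : z 0 i - eps i * x 0 i = eps i * (eps i * z 0 i - x 0 i).
      by rewrite mulrBr mulrA eps2 mul1r.
    have e1 : `|eps i| = 1 by case: (epsP i) => -[->|->] _; rewrite ?normrN normr1.
    by rewrite normrM e1 mul1r.
have q0 S : 0 < q S.
  rewrite lt_neqAle eq_sym; apply/andP; split.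
    rewrite mulf_neq0 //; apply/prodf_neq0 => i _; apply/eqP => ei.
    by have /eqP := eps2 i; rewrite ei mul0r eq_sym oner_eq0.
  by apply: affine_nonneg_coef => y y0; case: (orth y y0) => /ltW.
have prefix j : (j <= n)%N -> 0 < \prod_(i : 'I_n | (i < j)%N) eps i.
  case: j => [|j] jn; first by rewrite big_pred0.
  have := q0 [set i : 'I_n | (i < j.+1)%N]%SET; rewrite /q pmulr_rgt0 ?pj //.
  by congr (_ < _); apply: eq_bigl => i; rewrite inE.
(* Two consecutive prefix products of signs are positive, hence so is their quotient [eps i]. *)
have eps1 i : eps i = 1.
  have h1 := prefix i (ltnW (ltn_ord i)); have := prefix i.+1 (ltn_ord i).
  rewrite (bigD1 i) //= (eq_bigl (fun j : 'I_n => (j < i)%N)); last first.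
    by move=> j; rewrite ltnS ltn_neqAle andbC.
  by rewrite pmulr_lgt0 // => ei; case: (epsP i) ei => -[->|->] _ //; rewrite ltr0N1.
have flipE y : flip y = y by apply/rowP => i; rewrite mxE eps1 mul1r.
split.
- by move=> i; case: (epsP i) => _; rewrite eps1; apply: filterS => w; rewrite mul1r.
- by move=> y /orth; rewrite /mgamma_at qE LE flipE.
- by move=> S; have := q0 S; rewrite /q big1 ?mulr1.
Qed.

End OrthantMgamma.

(** * Uniqueness of Laplace transforms *)

Section DoubleExponential.
Context {R : realType}.

(* Power series in [expR (- x)] which tend to the indicator function of
   ]c, +oo[, also at c itself thanks to the factor N. *)
Definition dexp (c : R) (N : nat) (x : R) : R :=
  expR (- (N%:R * expR (N%:R * (c - x)))).

Lemma measurable_dexp c N : measurable_fun [set: R] (dexp c N).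
Proof.
apply: measurableT_comp => //; apply: measurableT_comp => //.
apply: measurable_funM => //; apply: measurableT_comp => //.
by apply: measurable_funM => //; exact: measurable_funB.
Qed.

Lemma cvg_dexp_gt (c x : R) : c < x -> dexp c N x @[N --> \oo] --> (1 : R).
Proof.
move=> cx; have y0 : 0 < x - c by rewrite subr_gt0.
(* From exp(y) >= y^2 / 2 at y = N (x - c), the inner term N exp(- y) is at most B / N. *)
pose B : R := 2 / (x - c) ^+ 2.
have inv_cvg : 1 - B / N%:R @[N --> \oo] --> (1 : R).
  rewrite -[X in _ --> X](subr0 1) -(mulr0 B); apply: cvgB; first exact: cvg_cst.
  apply: cvgMl_tmp; apply/gtr0_cvgV0.
    by near=> N; rewrite ltr0n; near: N; exact: nbhs_infty_gt.
  exact: cvgr_idn.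
apply: (squeeze_cvgr (f := fun N : nat => 1 - B / N%:R) (h := fun=> 1)) => //.
  near=> N; have N0 : 0 < N%:R :> R by rewrite ltr0n; near: N; exact: nbhs_infty_gt.
  apply/andP; split; last by rewrite -expR0 ler_expR oppr_le0 mulr_ge0 ?expR_ge0 // ltW.
  apply: le_trans (expR_ge1Dx _); rewrite lerD2l lerN2.
  have u0 : 0 <= N%:R * (x - c) by rewrite mulr_ge0 // ltW.
  have h : (N%:R * (x - c)) ^+ 2 / 2 <= expR (N%:R * (x - c)).
    by apply: le_trans (expR_ge1Dxn 1 u0); rewrite lerDr.
  have -> : c - x = - (x - c) by ring.
  rewrite mulrN expRN ler_pdivrMr ?expR_gt0 //.
  have := ler_wpM2l (_ : 0 <= B / N%:R) h; rewrite divr_ge0 ?(ltW N0) //; last first.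
    by rewrite /B divr_ge0 // sqr_ge0.
  move=> /(_ isT); apply: le_trans; rewrite /B le_eqVlt; apply/orP; left; apply/eqP.
  by field; rewrite !gt_eqF.
exact: cvg_cst.
Unshelve. all: by end_near. Qed.

Lemma cvg_dexp_le (c x : R) : x <= c -> dexp c N x @[N --> \oo] --> (0 : R).
Proof.
move=> xc; apply: (squeeze_cvgr (f := fun=> 0) (h := fun N : nat => expR (- N%:R))).
- near=> N; rewrite expR_ge0 /= ler_expR lerN2 ler_peMr // -expR0 ler_expR.
  by rewrite mulr_ge0 // subr_ge0.
- exact: cvg_cst.
- exact: cvgn_expR.
Unshelve. all: by end_near. Qed.

End DoubleExponential.

Section LaplaceUniqueness.
Context d (T : measurableType d) (R : realType).
Variable P : {measure set T -> \bar R}.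
Variable X : T -> R.
Hypothesis mX : measurable_fun [set: T] X.
Hypothesis X0 : {ae P, forall w, 0 <= X w}.
Implicit Types Z : T -> R.

Let measurable_expX (a : R) : measurable_fun [set: T] (fun w => expR (- a * X w)).
Proof. by apply: measurableT_comp => //; exact: measurable_funM. Qed.

Lemma exp_integrable Z (j : nat) : measurable_fun [set: T] Z -> (forall w, 0 <= Z w) ->
  P.-integrable [set: T] (EFin \o Z) ->
  P.-integrable [set: T] (EFin \o (fun w => Z w * expR (- j%:R * X w))).
Proof.
move=> mZ Z0 iZ; have mE : measurable_fun [set: T]
    (EFin \o (fun w => Z w * expR (- j%:R * X w))).
  by apply/measurable_EFinP; exact: measurable_funM.
apply/integrableP; split=> //; case/integrableP: iZ => mZe; apply: le_lt_trans.
apply: ae_ge0_le_integral => //; do ?exact: measurableT_comp.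
move: X0; apply: filterS => w Xw _ /=.
rewrite lee_fin ger0_norm ?mulr_ge0 ?expR_ge0 // ger0_norm // ler_piMr //.
by rewrite -expR0 ler_expR mulNr oppr_le0 mulr_ge0.
Qed.

(** With v = - N exp(N c), [dexp c N x] is exp(v exp(- N x)), whose series involves only the exp(- k
    N x): these integrals are determined by the transform at integers. As X >= 0, the partial sums
    are bounded by exp |v|. *)
Lemma cvg_dexp_series Z (c : R) (N : nat) : measurable_fun [set: T] Z ->
  (forall w, 0 <= Z w) -> P.-integrable [set: T] (EFin \o Z) ->
  (\sum_(0 <= k < K) (exp_coeff (- (N%:R * expR (N%:R * c))) k)%:E *
     \int[P]_w (Z w * expR (- (k * N)%:R * X w))%:E)%E @[K --> \oo] -->
  (\int[P]_w (Z w * dexp c N (X w))%:E)%E.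
Proof.
move=> mZ Z0 iZ; set v := - (N%:R * expR (N%:R * c)).
pose S K w := \sum_(0 <= k < K) exp_coeff v k * (Z w * expR (- (k * N)%:R * X w)).
have SE K w : S K w = Z w * series (exp_coeff (v * expR (- N%:R * X w))) K.
  rewrite /S /series /= mulr_sumr; apply: eq_bigr => k _.
  rewrite /exp_coeff /= exprMn -expRM_natl (_ : - (k * N)%:R * X w = k%:R * (- N%:R * X w)).
    by ring.
  by rewrite natrM; ring.
have -> : (fun K => \sum_(0 <= k < K) (exp_coeff v k)%:E *
     \int[P]_w (Z w * expR (- (k * N)%:R * X w))%:E)%E =
   (fun K => \int[P]_w (S K w)%:E)%E.
  apply/funext => K.
  transitivity (\int[P]_w (\sum_(0 <= k < K) (exp_coeff v k)%:E *
      (Z w * expR (- (k * N)%:R * X w))%:E))%E; last first.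
    by apply: eq_integral => w _; rewrite -sumEFin.
  rewrite integral_sum // => [|k].
    by apply: eq_bigr => k _; rewrite integralZl //; exact: exp_integrable.
  by apply: integrableZl => //; exact: exp_integrable.
have dE w : dexp c N (X w) = expR (v * expR (- N%:R * X w)).
  rewrite /dexp /v (_ : N%:R * (c - X w) = N%:R * c + - N%:R * X w); last by ring.
  by rewrite expRD; congr expR; ring.
have mS K : measurable_fun [set: T] (EFin \o S K).
  apply/measurable_EFinP; apply: measurable_sum => k.
  by apply: measurable_funM => //; exact: measurable_funM.
have [] // := @dominated_convergence _ _ _ P [set: T] measurableT
  (fun K => EFin \o S K) (fun w => (Z w * dexp c N (X w))%:E)
  (fun w => (expR `|v|)%:E * (Z w)%:E)%E.
- apply/measurable_EFinP; apply: measurable_funM => //.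
  exact: measurableT_comp (measurable_dexp c N) mX.
- apply: aeW => w _; apply: cvg_EFin; first exact: nearW.
  rewrite dE (_ : _ \o _ = fun K => Z w * series (exp_coeff (v * expR (- N%:R * X w))) K).
    by apply: cvgMl_tmp; exact: series_exp_coeff_cvg.
  by apply/funext => K; rewrite /= SE.
- exact: integrableZl.
- move: X0; apply: filterS => w Xw K _.
  rewrite /= SE lee_fin normrM ger0_norm // mulrC ler_wpM2r //.
  rewrite (le_trans (ler_norm_sum _ _ _)) //.
  have -> : \sum_(0 <= i < K) `|exp_coeff (v * expR (- N%:R * X w)) i| =
      series (exp_coeff `|v * expR (- N%:R * X w)|) K.
    by apply: eq_bigr => k _; rewrite /exp_coeff /= normrM normrX [`|_^-1|]ger0_norm.
  rewrite (le_trans (series_exp_coeff_le _ _)) // ler_expR normrM ler_piMr //.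
  by rewrite ger0_norm ?expR_ge0 // -expR0 ler_expR mulNr oppr_le0 mulr_ge0.
Qed.

Lemma cvg_dexp_integral Z (c : R) : measurable_fun [set: T] Z ->
  (forall w, 0 <= Z w) -> P.-integrable [set: T] (EFin \o Z) ->
  (\int[P]_w (Z w * dexp c N (X w))%:E)%E @[N --> \oo] -->
  (\int[P]_(w in X @^-1` `]c, +oo[) (Z w)%:E)%E.
Proof.
move=> mZ Z0 iZ; rewrite integral_mkcond.
have mA : measurable (X @^-1` `]c, +oo[).
  by rewrite -[X in measurable X]setTI; exact: mX.
apply: (@dominated_cvg _ _ _ P [set: T] measurableT _ _ (EFin \o Z)) => //.
- move=> N; apply/measurable_EFinP; apply: measurable_funM => //.
  exact: measurableT_comp (measurable_dexp c N) mX.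
- move=> w _; rewrite patchE; case: ifPn => [/set_mem|/negP nA].
    rewrite /= in_itv /= andbT => cX; apply: cvg_EFin; first exact: nearW.
    rewrite -[X in _ --> X]mulr1; apply: cvgMl_tmp; exact: cvg_dexp_gt.
  have cX : X w <= c.
    by rewrite leNgt; apply/negP => cX; apply: nA; rewrite inE /= in_itv /= andbT.
  apply: cvg_EFin; first exact: nearW.
  rewrite -[X in _ --> X](mulr0 (Z w)); apply: cvgMl_tmp; exact: cvg_dexp_le.
- move=> N w _ /=; rewrite lee_fin normrM ger0_norm // ler_piMr //.
  rewrite ger0_norm ?expR_ge0 // -expR0 ler_expR oppr_le0 mulr_ge0 //.
Qed.

(** Equality at the nonnegative integers passes to the integrals against [dexp c N], then, as N
    grows, to the rays ]c, +oo[, which are stable under intersection and generate the Borel sets.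
    The value j = 0 gives the whole line, needed for complements. *)
Lemma laplace_unique Z Z' : measurable_fun [set: T] Z -> measurable_fun [set: T] Z' ->
  (forall w, 0 <= Z w) -> (forall w, 0 <= Z' w) ->
  P.-integrable [set: T] (EFin \o Z) -> P.-integrable [set: T] (EFin \o Z') ->
  (forall j : nat, \int[P]_w (Z w * expR (- j%:R * X w))%:E =
                   \int[P]_w (Z' w * expR (- j%:R * X w))%:E)%E ->
  forall A, measurable A ->
  (\int[P]_(w in X @^-1` A) (Z w)%:E = \int[P]_(w in X @^-1` A) (Z' w)%:E)%E.
Proof.
move=> mZ mZ' Z0 Z'0 iZ iZ' H.
pose Q A := (\int[P]_(w in X @^-1` A) (Z w)%:E = \int[P]_(w in X @^-1` A) (Z' w)%:E)%E.
have QT : Q [set: R].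
  have := H 0%N; rewrite /Q preimage_setT.
  by under eq_integral do rewrite oppr0 mul0r expR0 mulr1;
     under [X in _ = X -> _]eq_integral do rewrite oppr0 mul0r expR0 mulr1.
have mpre A : measurable A -> measurable (X @^-1` A).
  by move=> mA; rewrite -[X in measurable X]setTI; exact: mX.
have QG : @RGenOInfty.G R `<=` Q.
  move=> _ [c ->]; rewrite /Q.
  have dE N : (\int[P]_w (Z w * dexp c N (X w))%:E = \int[P]_w (Z' w * dexp c N (X w))%:E)%E.
    have := cvg_dexp_series (c := c) (N := N) mZ' Z'0 iZ'.
    under eq_fun => K do under eq_bigr => k _ do rewrite -H.
    exact: cvg_unique (cvg_dexp_series (c := c) (N := N) mZ Z0 iZ).
  have := cvg_dexp_integral (c := c) mZ' Z'0 iZ'.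
  under eq_fun => N do rewrite -dE.
  exact: cvg_unique (cvg_dexp_integral (c := c) mZ Z0 iZ).
have split_int (U : T -> R) A : measurable_fun [set: T] U -> (forall w, 0 <= U w) ->
    measurable A ->
    (\int[P]_(w in X @^-1` [set: R]) (U w)%:E =
     \int[P]_(w in X @^-1` A) (U w)%:E + \int[P]_(w in X @^-1` (~` A)) (U w)%:E)%E.
  move=> mU U0 mA; rewrite preimage_setC preimage_setT -(setUv (X @^-1` A)).
  apply: ge0_integral_setU => //.
  - exact: mpre.
  - by apply: measurableC; exact: mpre.
  - by apply: measurable_funTS; exact/measurable_EFinP.
  - by move=> w _; rewrite lee_fin.
  - by rewrite disj_set2E setICr.
have mE : @measurable _ R = <<s @RGenOInfty.G R >> by exact: RGenOInfty.measurableE.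
move=> A mA; have : <<s @RGenOInfty.G R >> A by rewrite -mE.
apply: (@dynkin_induction _ _ (@RGenOInfty.G R) Q) => //.
- move=> _ _ [x ->] [y ->]; exists (Num.max x y).
  by apply/seteqP; split=> z; rewrite /= !in_itv /= !andbT gt_max => /andP.
- move=> S mS QS; have := split_int _ _ mZ Z0 mS; have := split_int _ _ mZ' Z'0 mS.
  rewrite /Q in QT QS *; rewrite QT QS => -> e.
  have fin : (\int[P]_(w in X @^-1` S) (Z' w)%:E)%E \is a fin_num.
    apply: integrable_fin_num; first exact: mpre.
    by apply: integrableS iZ' => //; exact: mpre.
  move: e; rewrite [LHS]addeC [RHS]addeC.
  move=> /(congr1 (fun z => z - \int[P]_(w in X @^-1` S) (Z' w)%:E)%E).
  by rewrite !addeK // => <-.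
- move=> F mF tF QF; rewrite /Q preimage_bigcup.
  rewrite !ge0_integral_bigcup //.
  + by apply: eq_eseriesr => i _; exact: QF.
  + by move=> k; exact: mpre.
  + by apply: measurable_funTS; exact/measurable_EFinP.
  + by move=> w _; rewrite lee_fin.
  + by move=> i j _ _ [w [Fi Fj]]; apply: tF => //; exists (X w).
  + by move=> k; exact: mpre.
  + by apply: measurable_funTS; exact/measurable_EFinP.
  + by move=> w _; rewrite lee_fin.
  + by move=> i j _ _ [w [Fi Fj]]; apply: tF => //; exists (X w).
Qed.

End LaplaceUniqueness.

(** * The conditional Laplace transform *)

Section ConditionalLaplace.
Context (R : realType) (n : nat) (l : R) (p : {set 'I_n.+1} -> R).
Hypothesis l0 : 0 < l.
Hypothesis p_empty : p finset.set0 = 1.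
Hypothesis p_gt0 : forall S, 0 < p S.

Let p1 := p [set ord0]%SET.
Let pt := ptilde p [set ord0]%SET.
Let p1_gt0 : 0 < p1. Proof. exact: p_gt0. Qed.
Let pn0 : p [set: 'I_n.+1]%SET != 0. Proof. by rewrite gt_eqF. Qed.
Let p1n0 : p [set ord0]%SET != 0. Proof. by rewrite gt_eqF. Qed.

Lemma pole_free_nonneg (t : 'rV[R]_n) : (forall i, 0 <= t 0 i) -> pole_free p t.
Proof.
move=> t0 i; rewrite gt_eqF // (lt_le_trans _ (t0 i)) // /ptilde mulNr oppr_lt0.
by rewrite divr_gt0.
Qed.

Lemma S_gt0 (t : 'rV[R]_n) : (forall i, 0 <= t 0 i) -> 0 < S_ p t.
Proof.
move=> t0; rewrite S_E //; last exact: pole_free_nonneg.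
rewrite mulr_gt0 ?invr_gt0 // /affine (bigD1 finset.set0) //= ltr_pwDl //.
  by rewrite big_set0 mulr1 tail_dcoefE.
apply: sumr_ge0 => T _; rewrite mulr_ge0 ?prodr_ge0 // tail_dcoefE.
exact: ltW.
Qed.

Lemma S_0 : S_ p (0 : 'rV[R]_n) = 1.
Proof.
rewrite S_E //; last by apply: pole_free_nonneg => i; rewrite mxE.
by rewrite affine0 tail_dcoefE imset0 finset.setU0 mulVf.
Qed.

(** The factorisation at the origin, where P and S equal 1, reads 1 = p_1 (- ptilde_1 - z(0)); this
    eliminates ptilde_1. *)
Lemma affine_zfrak (t : 'rV[R]_n) s : (forall i, 0 <= t 0 i) ->
  affine p (cons_row s t) = S_ p t * (1 + p1 * (s - zfrak p t + zfrak p 0)).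
Proof.
move=> t0.
have t00 (i : 'I_n) : 0 <= (0 : 'rV[R]_n) 0 i by rewrite mxE.
have E (u : 'rV[R]_n) r : (forall i, 0 <= u 0 i) ->
    affine p (cons_row r u) = p1 * S_ p u * (r - pt - zfrak p u).
  move=> u0; rewrite affine_SB //; last exact: pole_free_nonneg.
  by rewrite /zfrak -/p1 -/pt; field; rewrite gt_eqF // S_gt0.
have : affine p (cons_row 0 (0 : 'rV[R]_n)) = 1.
  rewrite -p_empty -affine0; congr affine; apply/rowP => i.
  by case: (unliftP ord0 i) => [j ->|->]; rewrite ?cons_rowS ?cons_row0 !mxE.
rewrite E // S_0 mulr1 sub0r E // => h.
rewrite [in RHS](_ : 1 = p1 * (- pt - zfrak p 0)); last by rewrite h.
by ring.
Qed.

Context d (T : measurableType d) (Pr : probability T R).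
Context (X : 'I_n.+1 -> T -> R).
Hypothesis mX : forall i, measurable_fun [set: T] (X i).
Hypothesis X0 : forall i, {ae Pr, forall w, 0 <= X i w}.
Hypothesis XP : forall y : 'rV[R]_n.+1, (forall i, 0 <= y 0 i) ->
  mgamma_at Pr X p l y.

Lemma mlaplace_cons s (t : 'rV[R]_n) :
  mlaplace Pr X (cons_row s t) =
  (\int[Pr]_w (expR (- \sum_(i < n) t 0 i * X (lift ord0 i) w) *
               expR (- s * X ord0 w))%:E)%E.
Proof.
apply: eq_integral => w _; congr EFin; rewrite -expRD; congr expR.
rewrite big_ord_recl cons_row0 opprD addrC mulNr; congr (- _ + _).
by apply: eq_bigr => i _; rewrite cons_rowS.
Qed.

Let cons_ge0 s (t : 'rV[R]_n) : 0 <= s -> (forall i, 0 <= t 0 i) ->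
  forall i, 0 <= cons_row s t 0 i.
Proof.
by move=> s0 t0 i; case: (unliftP ord0 i) => [j ->|->]; rewrite ?cons_rowS ?cons_row0.
Qed.

Let zero_ge0 (i : 'I_n) : 0 <= (0 : 'rV[R]_n) 0 i.
Proof. by rewrite mxE. Qed.

(** The transform is known on the nonnegative half-line only, whereas the one-variable results ask
    for a two-sided neighbourhood; this weight moves the centre to 1. *)
Let w1 : T -> R := fun w => expR (- 1 * X ord0 w).

Let laplace_near (t : R) : `|t| < 1 ->
  laplace Pr w1 (X ord0) t = ((1 + p1 + p1 * t) `^ (- l))%:E.
Proof.
rewrite ltr_norml => /andP[t1 t2].
have s0 : 0 <= 1 + t by lra.
have [_] := XP (cons_ge0 s0 zero_ge0).
rewrite affine_zfrak // S_0 mul1r mlaplace_cons => h.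
transitivity (((1 + p1 * (1 + t - zfrak p (0 : 'rV[R]_n) + zfrak p 0)) `^ (- l))%:E : \bar R).
  rewrite -h; apply: eq_integral => w _; congr EFin.
  rewrite big1 ?oppr0 ?expR0 ?mul1r => [|i _]; last by rewrite mxE mul0r.
  by rewrite /w1 -expRD; congr expR; ring.
by congr ((_ `^ _)%:E); ring.
Qed.

Let mw1 : measurable_fun [set: T] w1.
Proof. by apply: measurableT_comp => //; exact: measurable_funM. Qed.

Let w10 w : 0 < w1 w. Proof. exact: expR_gt0. Qed.

Let p11 : 0 < 1 + p1. Proof. by rewrite addr_gt0. Qed.

Lemma first_coord_gt0 : {ae Pr, forall w, 0 < X ord0 w}.
Proof. exact: (laplace_gamma_pos mw1 (mX ord0) w10 l0 p11 ltr01 p1_gt0 laplace_near). Qed.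

(** Stated beyond u >= 0 because it is applied at u = s - z(theta') + z(0), of which only 1 + p_1 u
    > 0 is known. *)
Lemma first_coord_laplace u : 0 < 1 + p1 * u ->
  (\int[Pr]_w (expR (- u * X ord0 w))%:E = ((1 + p1 * u) `^ (- l))%:E)%E.
Proof.
move=> u0.
have u1 : 0 < 1 + p1 + p1 * (u - 1) by rewrite (_ : _ + _ = 1 + p1 * u) //; ring.
have := laplace_gamma mw1 (mX ord0) w10 l0 p11 ltr01 laplace_near u1.
rewrite (_ : 1 + p1 + _ = 1 + p1 * u) => [<-|]; last by ring.
apply: eq_integral => w _; congr EFin.
by rewrite /w1 -expRD; congr expR; ring.
Qed.

Lemma cond_laplace (t : 'rV[R]_n) : (forall i, 0 <= t 0 i) ->
  cond_exp_version Pr [set x1 | 0 < x1]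
    (fun w => expR (- \sum_(i < n) t 0 i * X (lift ord0 i) w)) (X ord0)
    (fun x1 => S_ p t `^ (- l) *
              (G_ p l (zfrak p t * x1) / G_ p l (zfrak p 0 * x1))).
Proof.
move=> t0; pose z := zfrak p t; pose z0 := zfrak p (0 : 'rV[R]_n).
pose c := S_ p t `^ (- l).
have -> : (fun x1 => S_ p t `^ (- l) *
    (G_ p l (zfrak p t * x1) / G_ p l (zfrak p 0 * x1))) =
    (fun x1 => c * expR ((z - z0) * x1)).
  by apply/funext => x1; rewrite !G_expR // -expRB mulrBl.
set g := fun x1 => c * expR ((z - z0) * x1).
pose Y w := expR (- \sum_(i < n) t 0 i * X (lift ord0 i) w).
have mg : measurable_fun [set: R] g.
  by apply: measurable_funM => //; apply: measurableT_comp.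
have mgX : measurable_fun [set: T] (g \o X ord0) by exact: measurableT_comp.
have mY : measurable_fun [set: T] Y.
  apply: measurableT_comp => //; apply: measurableT_comp => //.
  by apply: measurable_sum => i; exact: measurable_funM.
have c0 : 0 <= c by exact: powR_ge0.
have S0 := S_gt0 t0.
have keyY s : 0 <= s -> (\int[Pr]_w (Y w * expR (- s * X ord0 w))%:E =
    (affine p (cons_row s t) `^ (- l))%:E)%E.
  by move=> s0; have [_ <-] := XP (cons_ge0 s0 t0); rewrite mlaplace_cons.
(* The exponential in [g] merges with exp(- s X_1), which leaves S^(-l) times the transform of X_1
   at the shifted point. *)
have keyg s : 0 <= s -> (\int[Pr]_w (g (X ord0 w) * expR (- s * X ord0 w))%:E =
    (affine p (cons_row s t) `^ (- l))%:E)%E.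
  move=> s0.
  have [A0 _] := XP (cons_ge0 s0 t0); rewrite affine_zfrak // pmulr_rgt0 // in A0.
  rewrite affine_zfrak // powRM ?(ltW A0) ?(ltW S0) // EFinM -first_coord_laplace //.
  rewrite -ge0_integralZl_EFin //.
  - apply: eq_integral => w _; rewrite -EFinM; congr EFin.
    by rewrite /g -mulrA -expRD; congr (_ * expR _); rewrite /z /z0; ring.
  - by apply/measurable_EFinP; apply: measurableT_comp => //; exact: measurable_funM.
have int_of (U : T -> R) : measurable_fun [set: T] U -> (forall w, 0 <= U w) ->
    (\int[Pr]_w (U w * expR (- 0 * X ord0 w))%:E =
    (affine p (cons_row 0 t) `^ (- l))%:E)%E -> Pr.-integrable [set: T] (EFin \o U).
  move=> mU U0 h; apply/integrableP; split; first exact/measurable_EFinP.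
  rewrite (_ : integral _ _ _ = (affine p (cons_row 0 t) `^ (- l))%:E) ?ltry // -h.
  by apply: eq_integral => w _; rewrite /= ger0_norm // oppr0 mul0r expR0 mulr1.
have Y0 w : 0 <= Y w by exact: expR_ge0.
have g0 w : 0 <= (g \o X ord0) w by rewrite /= mulr_ge0 ?expR_ge0.
have iY := int_of _ mY Y0 (keyY 0 (lexx 0)).
have ig := int_of _ mgX g0 (keyg 0 (lexx 0)).
have mD : measurable [set x1 : R | 0 < x1].
  rewrite (_ : [set x1 | 0 < x1] = `]0, +oo[%classic) //.
  by apply/seteqP; split=> x; rewrite /= in_itv /= andbT.
have mXD : measurable (X ord0 @^-1` [set x1 | 0 < x1]).
  by rewrite -[X in measurable X]setTI; exact: mX.
split.
- have h : Pr (~` (X ord0 @^-1` [set x1 | 0 < x1])) = 0%E.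
    by apply: measure_negligible first_coord_gt0; exact: measurableC.
  by rewrite -[X in Pr X]setCK probability_setC ?h ?sube0 //; exact: measurableC.
- exact: iY.
- exact: measurable_funTS.
- by apply: integrableS ig.
- move=> A mA _.
  apply: (laplace_unique (mX ord0) (X0 ord0) mY mgX Y0 g0 iY ig) => // j.
  by rewrite keyY // keyg.
Qed.

End ConditionalLaplace.

Theorem theorem24 (R : realType) (n : nat) (hn : (2 <= n.+1)%N)
    (lambda : R) (hlambda : 0 < lambda)
    (p : {set 'I_n.+1} -> R)
    (hp_empty : p finset.set0 = 1)
    (hp_neq0 : forall T : {set 'I_n.+1}, p T != 0)
    (hp_gt0 : forall j : nat, (1 <= j <= n.+1)%N ->
       0 < p [set i : 'I_n.+1 | (i < j)%N]%SET)
    (mu : probability (n.+1.-tuple R) R)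
    (hmu : is_mgamma mu p lambda)
    (hinfdiv : mgamma_infdiv p lambda)
    (d : measure_display) (Omega : measurableType d)
    (Pr : probability Omega R)
    (X : {RV Pr >-> n.+1.-tuple R})
    (hX : forall A : set (n.+1.-tuple R), measurable A ->
       distribution Pr X A = mu A) :
  [/\ (exists s : {set 'I_n} -> R, forall theta' : 'rV[R]_n,
         pole_free p theta' -> S_ p theta' = affine s theta'),
      (exists b : {set 'I_n} -> R, forall theta' : 'rV[R]_n,
         pole_free p theta' -> B_ p theta' = affine b theta'),
      (forall (theta1 : R) (theta' : 'rV[R]_n), pole_free p theta' ->
         [/\ S_ p theta' = (p [set ord0]%SET)^-1 *
               partial ord0 (affine p) (cons_row theta1 theta'),
             S_ p theta' = \sum_(T : {set 'I_n})
               p (ord0 |: [set lift ord0 i | i in T])%SET / p [set ord0]%SET *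
               \prod_(i in T) theta' 0 i &
             B_ p theta' = - (p [set ord0]%SET)^-1 *
               affine p (cons_row (ptilde p [set ord0]%SET) theta')]),
      (forall theta' : 'rV[R]_n, pole_free p theta' -> S_ p theta' != 0 ->
         zfrak p theta' = partial ord0 (R_ p) (cons_row 0 (w_ p theta')) /
                          (1 - R_ p (cons_row 0 (w_ p theta')))) &
      has_power_series (c_ p lambda) (fun z => (1 - R_ p z) `^ (- lambda)) /\
      (forall theta' : 'rV[R]_n, (forall i, 0 <= theta' 0 i) ->
         cond_laplace_version Pr X theta'
           (fun x1 => S_ p theta' `^ (- lambda) *
              (G_ p lambda (zfrak p theta' * x1) /
               G_ p lambda (zfrak p 0 * x1))))].
Proof.
have pn0 := hp_neq0 [set: 'I_n.+1]%SET; have p10 := hp_neq0 [set ord0]%SET.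
pose Y i (w : Omega) := tnth (X w) i.
have mY i : measurable_fun [set: Omega] (Y i).
  exact: measurableT_comp (measurable_tnth i) _.
have [U [[x0 x0i] HU]] := hmu.
have /nbhs_ballP[e /= e0 ball_e] := x0i.
have law (y : 'rV[R]_n.+1) : (forall i, `|y 0 i - x0 0 i| < e) ->
    mgamma_at Pr Y p lambda y.
  (* The hypothesis concerns [mu]; it is carried to [Omega] by change of variables along X. *)
  move=> ye; have [|A0 I] := HU y.
    by apply: ball_e; split=> // i j; rewrite ord1 /ball /= distrC.
  split=> //; rewrite -I /mlaplace.
  rewrite (eq_measure_integral (distribution Pr X)) => [|A mA _]; last first.
    exact/esym/hX.
  rewrite ge0_integral_pushforward //.
  apply/measurable_EFinP; apply: measurableT_comp => //; apply: measurableT_comp => //.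
  by apply: measurable_sum => i; apply: measurable_funM => //; exact: measurable_tnth.
have [Y0 YP p_gt0] := mgamma_orthant hlambda e0 hp_neq0 hp_gt0 mY law.
split.
- exists (fun T => (p [set ord0]%SET)^-1 * tail_coef (dcoef ord0 p) T) => t pf.
  by rewrite affine_scale S_E.
- have [b bE] := affine_cons_affine p (ptilde p [set ord0]%SET).
  exists (fun T => - (p [set ord0]%SET)^-1 * b T) => t pf.
  by rewrite affine_scale B_E // bE.
- move=> theta1 t pf; split; last exact: B_E.
    by rewrite partial_cons S_E.
  rewrite S_E // /affine mulr_sumr; apply: eq_bigr => T _.
  by rewrite tail_dcoefE mulrA [_^-1 * _]mulrC.
(* A nonzero S forces the prefactor common to S and B to be nonzero, so that it cancels. *)
- move=> t pf S0; rewrite /zfrak /S_ /B_ -mulf_div divff ?mul1r //.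
  by apply: contraNneq S0 => k0; rewrite /S_ k0 mul0r.
- split; first exact: c_has_power_series.
  by move=> t t0; exact: (cond_laplace hlambda hp_empty p_gt0 mY Y0 YP t0).
Qed.
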